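(* Let $\alpha\in[1,2]$, $a>0$, and let $\mu$ be a probability measure on $\mathbb{R}^n$ satisfying the inequality $LSI_{a,\alpha}(C)$. Then $\mu$ satisfies the transportation inequality $T_{\frac{aC}{2},\alpha}(C/4)$.
   Context: For $\alpha\in[1,2]$ let $\beta\in[2,\infty]$ satisfy $1/\alpha+1/\beta=1$ ($\beta=\infty$ if $\alpha=1$), and let $a>0$. For $\alpha\in(1,2]$ and $x\in\mathbb{R}$: $L_{a,\alpha}(x)=\frac{x^2}{2}$ if $|x|\le a$, $L_{a,\alpha}(x)=a^{2-\alpha}\frac{|x|^\alpha}{\alpha}+a^2\frac{\alpha-2}{2\alpha}$ if $|x|\ge a$; $H_{a,\alpha}(x)=\frac{x^2}{2}$ if $|x|\le a$, $H_{a,\alpha}(x)=a^{2-\beta}\frac{|x|^\beta}{\beta}+a^2\frac{\beta-2}{2\beta}$ if $|x|\ge a$. For $\alpha=1$: $L_{a,1}(x)=\frac{x^2}{2}$ if $|x|\le a$, $L_{a,1}(x)=a|x|-\frac{a^2}{2}$ if $|x|\ge a$; $H_{a,1}(x)=\frac{x^2}{2}$ if $|x|\le a$, $H_{a,1}(x)=+\infty$ if $|x|>a$. For $x\in\mathbb{R}^n$, $L_{a,\alpha}(x)=\sum_{i=1}^nL_{a,\alpha}(x_i)$ and $H_{a,\alpha}(x)=\sum_{i=1}^nH_{a,\alpha}(x_i)$. $LSI_{a,\alpha}(C)$: for every $C^\infty$ and $L^2$ function $f$ on $\mathbb{R}^n$, $\mathbf{Ent}_\mu(f^2)\le C\int H_{a,\alpha}\big(\frac{\nabla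 f}{f}\big)f^2d\mu$, where $H_{a,\alpha}(\frac{\nabla f}{f})=\sum_{i=1}^nH_{a,\alpha}\big(\frac{\partial f}{\partial x_i}\frac1f\big)$, with the convention $0/0=\infty$, and $\mathbf{Ent}_\mu(g)=\int g\log\frac{g}{\int g\,d\mu}d\mu$ for $g\ge0$. $T_{a,\alpha}(C)$: for every probability density $F$ with respect to $\mu$, $T_{L_{a,\alpha}}(Fd\mu,d\mu)\le C\,\mathbf{Ent}_\mu(F)$, where $T_{L_{a,\alpha}}(Fd\mu,d\mu)=\inf_\pi\int L_{a,\alpha}(x-y)\,d\pi(x,y)$, the infimum being over probability measures $\pi$ on $\mathbb{R}^n\times\mathbb{R}^n$ with marginals $Fd\mu$ and $\mu$. *)

(* Defs.v *)
From HB Require Import structures.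
From mathcomp Require Export all_boot all_order all_algebra.
From mathcomp Require Export all_classical all_reals all_analysis.

Set Implicit Arguments.
Unset Strict Implicit.
Unset Printing Implicit Defensive.

Import Order.TTheory GRing.Theory Num.Theory.
Import numFieldNormedType.Exports.

Local Open Scope classical_set_scope.
Local Open Scope ring_scope.

(* Alias of 'rV[R]_n carrying the Borel sigma-algebra, which the library does
   not put on row vectors. *)
Definition borelRn (R : realType) (n : nat) : Type := 'rV[R]_n.

Fact borelRn_display : measure_display.
Proof. exact: default_measure_display. Qed.

Section borelRn_measurable.
Variables (R : realType) (n : nat).
Let G : set (set (borelRn R n)) := @open 'rV[R]_n.

HB.instance Definition _ := Pointed.copy (borelRn R n) 'rV[R]_n.
HB.instance Definition _ := @isMeasurable.Build borelRn_display (borelRn R n)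
  <<s G >> (@sigma_algebra0 _ setT G) (@sigma_algebraC _ G)
  (@sigma_algebra_bigcup _ setT G).

End borelRn_measurable.

Section cost_functions.
Context {R : realType}.
Implicit Types a alpha x : R.

(* For alpha = 1 the second branch is a * `|x| - a ^+ 2 / 2. *)
Definition L1 a alpha x : R :=
  if `|x| <= a then x ^+ 2 / 2
  else a `^ (2 - alpha) * (`|x| `^ alpha / alpha)
       + a ^+ 2 * ((alpha - 2) / (2 * alpha)).

(* The exponent beta is hoelder_conjugate alpha%:E: the real number
   alpha / (alpha - 1) if alpha > 1, and +oo if alpha = 1. *)
Definition H1 a alpha x : \bar R :=
  if `|x| <= a then (x ^+ 2 / 2)%:E
  else match hoelder_conjugate alpha%:E with
       | beta%:E => (a `^ (2 - beta) * (`|x| `^ beta / beta)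
                     + a ^+ 2 * ((beta - 2) / (2 * beta)))%:E
       | _ => +oo%E
       end.

Definition H1e a alpha (x : \bar R) : \bar R :=
  if x is r%:E then H1 a alpha r else +oo%E.

(* Quotient with the convention 0 / 0 = oo; the sign of y / 0 is immaterial
   since H1e is even. *)
Definition equot (y z : R) : \bar R :=
  if z == 0 then +oo%E else (y / z)%:E.

Definition Lcost (n : nat) a alpha (x : 'rV[R]_n) : R :=
  \sum_(i < n) L1 a alpha (x 0 i).

End cost_functions.

Section differential_calculus.
Context {R : realType} {n : nat}.
Implicit Type f : 'rV[R]_n -> R.

Definition partial (i : 'I_n) f : 'rV[R]_n -> R :=
  fun x => 'D_(delta_mx 0 i) f x.

Definition smooth f : Prop :=
  forall s : seq 'I_n,
    let g := foldr partial f s in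
    continuous g /\ forall (i : 'I_n) (x : 'rV[R]_n),
      derivable g x (delta_mx 0 i).

Definition Hgrad (a alpha : R) f (x : 'rV[R]_n) : \bar R :=
  (\sum_(i < n) H1e a alpha (equot (partial i f x) (f x)))%E.

End differential_calculus.

Section inequalities.
Context {R : realType} {n : nat}.

Definition Ent (mu : probability (borelRn R n) R) (g : borelRn R n -> R) : \bar R :=
  (\int[mu]_x (g x * ln (g x / (\int[mu]_y g y)%R))%:E)%E.

(* At a zero of f the integrand on the right is +oo * 0 = 0. *)
Definition LSI (a alpha C : R) (mu : probability (borelRn R n) R) : Prop :=
  forall f : borelRn R n -> R, smooth f -> f \in Lfun mu 2%:E ->
    (Ent mu (fun x => f x ^+ 2)%R
       <= C%:E * \int[mu]_x (Hgrad a alpha f x * (f x ^+ 2)%:E))%E.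

Definition density (mu : probability (borelRn R n) R) (F : borelRn R n -> R) :
    Prop :=
  [/\ measurable_fun setT F, forall x, 0 <= F x
    & (\int[mu]_x (F x)%:E = 1)%E].

Definition has_marginals
    (pi : probability (borelRn R n * borelRn R n)%type R)
    (nu1 nu2 : set (borelRn R n) -> \bar R) : Prop :=
  forall A : set (borelRn R n), measurable A ->
    pi (A `*` setT) = nu1 A /\ pi (setT `*` A) = nu2 A.

Definition transport_cost (a alpha : R)
    (nu1 nu2 : set (borelRn R n) -> \bar R) : \bar R :=
  ereal_inf [set (\int[pi]_z (Lcost a alpha (z.1 - z.2 : 'rV[R]_n)%R)%:E)%E
            | pi in [set pi | has_marginals pi nu1 nu2]].

Definition transport_inequality (a alpha C : R)
    (mu : probability (borelRn R n) R) : Prop :=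
  forall F : borelRn R n -> R, density mu F ->
    (transport_cost a alpha (fun A => \int[mu]_(x in A) (F x)%:E) mu
       <= C%:E * Ent mu F)%E.

End inequalities.

(* Main.v *)
From HB Require Import structures.
From mathcomp Require Import ring lra measurable_realfun.
Require Import Defs.

(* Write b = aC/2 and k = 4/C.  By duality it is enough to show that
   int phi dnu + int psi dmu <= (C/4) Ent(F), nu = F mu, for potentials with
   phi(x) + psi(y) <= L_b(x - y).  The Hopf-Lax solution u(t, x) started from
   -psi satisfies u_t = -H_b(grad u) and phi <= u(1, .); applying LSI to
   exp(k t u / 2), together with C H_a(k t p / 2) <= k t^2 H_b(p) for t <= 1,
   shows that (1/t) ln int exp(k t u(t, .)) dmu is nonincreasing on (0, 1], so
   ln int exp(k phi) dmu <= -k int psi dmu, and the Gibbs inequality concludes.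

   LSI needs smooth functions, and no mollification is used: for potentials
   taking finitely many values, u is replaced by a soft minimum of soft maxima
   of functions affine in (t, x), each of them a solution of the
   Hamilton-Jacobi equation.  Its derivatives are averages of theirs with common
   weights, hence by convexity of H it is a smooth bounded subsolution.

   The coupling is found on a grid of mesh delta: the transport problem lumping
   all but N cells together, with a quadratic penalty for the marginals, has a
   minimiser whose optimality conditions are the potentials above; an ultrafilter
   limit N -> oo gives an array with the exact marginals, which is spread out
   over the cells by product measures.  Finally delta -> 0. *)

Set Implicit Arguments.
Unset Strict Implicit.
Unset Printing Implicit Defensive.

Import Order.TTheory GRing.Theory Num.Theory.
Import numFieldNormedType.Exports.
Local Open Scope classical_set_scope.
Local Open Scope ring_scope.

(** * The one-dimensional cost and its conjugate *)

Section cost.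
Context {R : realType}.
Implicit Types a b alpha beta s t p w z C : R.

(** The constants are fixed by the quadratic regime: there [C H_a(k t p / 2)] equals
    [C k^2 t^2 p^2 / 8], which is [k t^2 p^2 / 2] for [k = 4/C], and [k |p| / 2 <= a] means
    [|p| <= aC/2 = b]. Outside that regime the factor [t^2] rests on [H(t p) <= t^2 H(p)] for
    [t <= 1], true because [beta >= 2] makes [u |-> H(sqrt u)] convex. The soft extrema carry a
    temperature [e] and cost a multiple of [e ln(N+1)]. Hence the order of the limits: [e -> 0] for
    fixed [N] and mesh, then [N -> oo], then [delta -> 0]. Lumping serves twice. It makes the
    discrete problem finite, and since the remainder cell is reached at cost 0 it puts constants
    among the affine functions, which is what bounds the potentials on the whole space. The mesh
    error is proportional to the derivative of the cost, which is unbounded when [alpha > 1]; it is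
    absorbed into a factor tending to 1 and an additive term tending to 0. *)

Definition dL1 b alpha z : R :=
  if `|z| <= b then z else Num.sg z * (b `^ (2 - alpha) * `|z| `^ (alpha - 1)).

(** Young's inequality for [z] and [s^(alpha-1)] with exponents [alpha] and [alpha/(alpha-1)],
    rearranged. At [alpha = 1] the conjugate exponent is infinite and both sides are linear. *)
Lemma powR_tangent alpha s z : 1 <= alpha -> 0 < s -> 0 <= z ->
  s `^ alpha + alpha * s `^ (alpha - 1) * (z - s) <= z `^ alpha.
Proof.
move=> a1 s0 z0; have [<-|a1'] := eqVneq 1 alpha.
  by rewrite subrr powRr0 !powRr1 ?(ltW s0)// !mul1r addrC subrK.
have {a1 a1'} a1 : 1 < alpha by rewrite lt_neqAle a1'.
have a0 : 0 < alpha by apply: lt_trans a1.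
have b0 : 0 < alpha - 1 by rewrite subr_gt0.
have := @conjugate_powR R z (s `^ (alpha - 1)) alpha (alpha / (alpha - 1)) z0
  (powR_ge0 _ _) a0 (divr_gt0 a0 b0).
rewrite -powRrM mulrCA divff ?gt_eqF// mulr1 invf_div => /(_ _)/wrap[].
  by field; rewrite gt_eqF.
move=> H.
have -> : s `^ alpha + alpha * s `^ (alpha - 1) * (z - s) =
   alpha * (z * s `^ (alpha - 1)) - (alpha - 1) * s `^ alpha.
  by rewrite -(@mulr_powRB1 R s alpha) ?ltW//; ring.
have : alpha * (z * s `^ (alpha - 1)) <=
  alpha * (z `^ alpha / alpha + s `^ alpha * ((alpha - 1) / alpha)).
  by rewrite ler_pM2l.
have -> : alpha * (z `^ alpha / alpha + s `^ alpha * ((alpha - 1) / alpha)) =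
   z `^ alpha + (alpha - 1) * s `^ alpha by field; rewrite gt_eqF.
lra.
Qed.

Lemma L1_abs b alpha z : L1 b alpha `|z| = L1 b alpha z.
Proof. by rewrite /L1 normr_id real_normK ?num_real. Qed.

Lemma dL1_abs b alpha z : 0 < b -> dL1 b alpha z = Num.sg z * dL1 b alpha `|z|.
Proof.
move=> b0; rewrite /dL1 normr_id; case: ifPn => h; first by rewrite -numEsg.
rewrite (_ : Num.sg `|z| = 1) ?mul1r//; apply: gtr0_sg; rewrite normr_gt0.
by apply: contraNneq h => ->; rewrite normr0 ltW.
Qed.

Lemma dL1_ge0 b alpha z : 0 <= z -> 0 <= dL1 b alpha z.
Proof.
move=> z0; rewrite /dL1; case: ifP => // _.
by rewrite !mulr_ge0 ?powR_ge0// sgr_ge0.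
Qed.

Lemma normr_dL1 b alpha z : 0 < b -> `|dL1 b alpha z| = dL1 b alpha `|z|.
Proof.
move=> b0; rewrite dL1_abs// normrM normr_sg.
case: eqVneq => [->|]; last by rewrite mul1r ger0_norm// dL1_ge0.
by rewrite mul0r normr0 /dL1 normr0 ltW.
Qed.

Lemma dL1_big b alpha z : 0 < b -> b < z ->
  dL1 b alpha z = b `^ (2 - alpha) * z `^ (alpha - 1).
Proof.
move=> b0 bz; have z0 : 0 < z by apply: lt_trans bz.
by rewrite /dL1 (ger0_norm (ltW z0)) leNgt bz/= gtr0_sg// mul1r.
Qed.

Lemma powR2B b alpha : 0 < b -> b `^ (2 - alpha) * b `^ alpha = b ^+ 2.
Proof.
move=> b0; rewrite -powRD; last by rewrite (gt_eqF b0) implybT.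
by rewrite subrK powR_mulrn ?(ltW b0).
Qed.

Lemma powR1B b alpha : 0 < b -> b `^ (2 - alpha) * b `^ (alpha - 1) = b.
Proof.
move=> b0; rewrite -powRD; last by rewrite (gt_eqF b0) implybT.
by rewrite (_ : 2 - alpha + (alpha - 1) = 1) ?powRr1 ?(ltW b0)//; ring.
Qed.

Let lpow b alpha z : R := b `^ (2 - alpha) * (z `^ alpha / alpha)
       + b ^+ 2 * ((alpha - 2) / (2 * alpha)).

Let lpow_tangent b alpha s z : 1 <= alpha -> 0 < b -> 0 < s -> 0 <= z ->
  lpow b alpha s + b `^ (2 - alpha) * s `^ (alpha - 1) * (z - s) <= lpow b alpha z.
Proof.
move=> a1 b0 s0 z0; have H := powR_tangent a1 s0 z0.
have a0 : 0 < alpha by lra.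
rewrite /lpow addrAC lerD2r -mulrA -mulrDr ler_pM2l ?powR_gt0//.
rewrite ler_pdivlMr// mulrDl divfK ?gt_eqF//; lra.
Qed.

Let lpowb b alpha : 1 <= alpha -> 0 < b -> lpow b alpha b = b ^+ 2 / 2.
Proof.
move=> a1 b0; rewrite /lpow mulrA powR2B//; field.
by rewrite gt_eqF//; lra.
Qed.

(** The quadratic and the power branch agree at [b] in value and slope, so when [s] and [z] lie on
    different sides of [b] the tangent inequalities of the two branches are chained through [b]. *)
Lemma ge0_L1_tangent b alpha s z : 1 <= alpha -> 0 < b -> 0 <= s -> 0 <= z ->
  L1 b alpha s + dL1 b alpha s * (z - s) <= L1 b alpha z.
Proof.
move=> a1 b0 s0 z0.
have tb : b <= z -> b ^+ 2 / 2 + b * (z - b) <= lpow b alpha z.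
  move=> bz; have := lpow_tangent a1 b0 b0 z0.
  by rewrite lpowb// powR1B.
have Lz : b < z -> L1 b alpha z = lpow b alpha z.
  by move=> bz; rewrite /L1 ger0_norm// leNgt bz.
have [sb|bs] := lerP s b.
  have -> : L1 b alpha s = s ^+ 2 / 2 by rewrite /L1 ger0_norm// sb.
  have -> : dL1 b alpha s = s by rewrite /dL1 ger0_norm// sb.
  have [zb|bz] := lerP z b.
    rewrite /L1 (ger0_norm z0) zb; have := sqr_ge0 (z - s); nra.
  rewrite Lz//; apply: le_trans (tb (ltW bz)).
  have : 0 <= (b - s) * (z - (b + s) / 2) by apply: mulr_ge0; lra.
  nra.
have s0' : 0 < s by lra.
rewrite dL1_big//.
have -> : L1 b alpha s = lpow b alpha s by rewrite /L1 ger0_norm// leNgt bs.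
have [zb|bz] := lerP z b; last by rewrite Lz//; exact: lpow_tangent.
rewrite /L1 (ger0_norm z0) zb.
have := lpow_tangent a1 b0 s0' (ltW b0); rewrite lpowb//.
have : b <= b `^ (2 - alpha) * s `^ (alpha - 1).
  rewrite -{1}(powR1B alpha b0) ler_pM2l ?powR_gt0//.
  by rewrite ge0_ler_powR ?nnegrE ?subr_ge0// ltW.
set q := _ * _; nra.
Qed.

Lemma L1_tangent b alpha z w : 1 <= alpha -> 0 < b ->
  L1 b alpha z + dL1 b alpha z * (w - z) <= L1 b alpha w.
Proof.
move=> a1 b0; rewrite -(L1_abs _ _ z) -(L1_abs _ _ w).
apply: le_trans (ge0_L1_tangent a1 b0 (normr_ge0 z) (normr_ge0 w)).
rewrite lerD2l !mulrBr lerB//.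
  by rewrite -normr_dL1// (le_trans (ler_norm _))// normrM.
by rewrite (dL1_abs _ z)// mulrAC -normrEsg mulrC.
Qed.

Lemma L1_ge0 b alpha z : 1 <= alpha -> 0 < b -> 0 <= L1 b alpha z.
Proof.
move=> a1 b0; have := L1_tangent 0 z a1 b0.
have -> : L1 b alpha 0 = 0 by rewrite /L1 normr0 (ltW b0) expr0n/= mul0r.
by have -> : dL1 b alpha 0 = 0 by [rewrite /dL1 normr0 (ltW b0)]; rewrite mul0r addr0.
Qed.

(** This pays for the grid: a displacement of order [delta] then changes the cost by a small
    multiple of itself plus a constant. Beyond [b], [alpha <= 2] gives [|dL1 z| <= |z|], and the
    tangent at [b] makes [L1] grow at least linearly. *)
Lemma dL1_le b alpha z : 1 <= alpha <= 2 -> 0 < b ->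
  `|dL1 b alpha z| <= b + 2 / b * L1 b alpha z.
Proof.
move=> /andP[a1 a2] b0; rewrite normr_dL1//.
have L0 := L1_ge0 z a1 b0.
have [zb|bz] := lerP `|z| b.
  by rewrite {1}/dL1 normr_id zb ler_wpDr// mulr_ge0// divr_ge0// ltW.
rewrite dL1_big//.
have : b `^ (2 - alpha) * `|z| `^ (alpha - 1) <= `|z|.
  rewrite -[leRHS](powR1B alpha) ?(lt_trans b0)// ler_pM2r ?powR_gt0 ?(lt_trans b0)//.
  by rewrite ge0_ler_powR ?nnegrE ?subr_ge0// ltW.
move=> /le_trans; apply.
have := ge0_L1_tangent a1 b0 (ltW b0) (normr_ge0 z); rewrite L1_abs.
have -> : L1 b alpha b = b ^+ 2 / 2 by rewrite /L1 gtr0_norm// lexx.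
have -> : dL1 b alpha b = b by rewrite /dL1 gtr0_norm// lexx.
move=> H; have -> : 2 / b * L1 b alpha z = L1 b alpha z * 2 / b by ring.
rewrite -lerBlDl ler_pdivlMr//; nra.
Qed.

Lemma H1_real b alpha p : `|p| <= b -> H1 b alpha p = (p ^+ 2 / 2)%:E.
Proof. by rewrite /H1 => ->. Qed.

Lemma hoelder_conjugate_gt1 alpha : 1 < alpha ->
  hoelder_conjugate alpha%:E = (alpha / (alpha - 1))%:E.
Proof.
move=> a1; have a0 : 0 < alpha by apply: lt_trans a1.
rewrite /hoelder_conjugate/= eqe gt_eqF//.
by rewrite -EFinB inver subr_eq0 gt_eqF//.
Qed.

(* [H] at scale [a] against the Legendre transform of [L] at scale [a C / 2];
   giving the maximiser [w] avoids introducing the conjugate of [L1]. *)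
Lemma H1_scaling alpha a C t p : 1 <= alpha <= 2 -> 0 < a -> 0 < C ->
    0 < t <= 1 -> (alpha = 1 -> `|p| <= a * C / 2) ->
  exists h w, H1 a alpha (2 * t / C * p) = h%:E /\
    C * h <= 4 * t ^+ 2 / C * (p * w - L1 (a * C / 2) alpha w).
Proof.
move=> /andP[a1 a2] a0 C0 /andP[t0 t1] hp.
set b := a * C / 2; have b0 : 0 < b by rewrite /b; apply: divr_gt0 => //; exact: mulr_gt0.
have tC : 0 < 2 * t / C by rewrite divr_gt0// mulr_gt0.
have nE : `|2 * t / C * p| = 2 * t / C * `|p| by rewrite normrM gtr0_norm.
have sm : (`|2 * t / C * p| <= a) = (t * `|p| <= b).
  by rewrite nE mulrAC ler_pdivrMr// /b ler_pdivlMr//; congr (_ <= _); ring.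
have [pb|bp] := lerP `|p| b.
  (* In the quadratic regime the maximiser is [w = p], and the bound is an equality. *)
  exists ((2 * t / C * p) ^+ 2 / 2), p; split.
    rewrite H1_real// sm; apply: le_trans pb; have := normr_ge0 p; nra.
  rewrite /L1 pb le_eqVlt; apply/orP; left; apply/eqP; field.
  by rewrite gt_eqF.
have {a1} a1 : 1 < alpha.
  by rewrite lt_neqAle a1 andbT; apply: contraTneq bp => /esym/hp; rewrite -leNgt.
pose e := (alpha - 1)^-1; pose beta := alpha / (alpha - 1).
have e0 : 0 < e by rewrite invr_gt0 subr_gt0.
have al0 : 0 < alpha by lra.
have betaE : beta = e + 1 by rewrite /beta /e; field; rewrite subr_eq0 gt_eqF.
have beta2 : 2 <= beta by rewrite /beta ler_pdivlMr; lra.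
pose r := `|p| / b.
have r1 : 1 < r by rewrite /r ltr_pdivlMr// mul1r.
have r0 : 0 < r by lra.
have pE : `|p| = b * r by rewrite /r; field; rewrite gt_eqF.
(* [hh] is the conjugate cost rescaled to threshold 1. Both sides reduce to it, and what remains is
   [hh (t * r) <= t ^+ 2 * hh r]. *)
pose hh s := if s <= 1 then s ^+ 2 / 2 else s `^ beta / beta + (beta - 2) / (2 * beta).
have beta0 : 0 < beta by lra.
have E1 : H1 a alpha (2 * t / C * p) = (a ^+ 2 * hh (t * r))%:E.
  have yE : `|2 * t / C * p| = a * (t * r).
    by rewrite nE pE /b; field; rewrite gt_eqF.
  have smr : (`|2 * t / C * p| <= a) = (t * r <= 1).
    by rewrite yE -[X in _ <= X]mulr1 ler_pM2l.
  rewrite /H1 smr /hh; case: ifPn => h.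
    by rewrite -real_normK ?num_real// yE; congr EFin; ring.
  rewrite hoelder_conjugate_gt1// -/beta yE; congr EFin.
  rewrite powRM ?(ltW a0)//; last by rewrite mulr_ge0// ltW.
  by rewrite -!mulrA mulrA powR2B//; ring.
have p1 x : (1 : R) `^ x = 1 by rewrite powR1.
have re1 : 1 < r `^ e.
  by rewrite -[ltLHS](p1 e); apply: gt0_ltr_powR; rewrite // ?nnegrE ltW.
(* The witness [w] solves [dL1 b alpha w = p]. *)
exists (a ^+ 2 * hh (t * r)), (Num.sg p * (b * r `^ e)); split => //.
have wE : `|Num.sg p * (b * r `^ e)| = b * r `^ e.
  rewrite normrM normr_sg (_ : p != 0) ?mul1r; last first.
    by rewrite -normr_gt0 (lt_trans b0).
  by rewrite ger0_norm// mulr_ge0// ?powR_ge0// ltW.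
have pw : p * (Num.sg p * (b * r `^ e)) = b ^+ 2 * r `^ beta.
  rewrite mulrA [p * _]mulrC -normrEsg pE betaE powRD; last first.
    by rewrite (gt_eqF r0) implybT.
  by rewrite powRr1 ?(ltW r0)//; ring.
have Lw : L1 b alpha (Num.sg p * (b * r `^ e)) =
    b ^+ 2 * (r `^ beta / alpha + (alpha - 2) / (2 * alpha)).
  rewrite /L1 wE leNgt (_ : b < _) ?ltr_pMr//=.
  rewrite powRM ?powR_ge0 ?(ltW b0)// -powRrM.
  have -> : e * alpha = beta by rewrite /e /beta mulrC.
  by rewrite -(powR2B alpha b0); ring.
rewrite pw Lw.
have -> : 4 * t ^+ 2 / C * (b ^+ 2 * r `^ beta -
    b ^+ 2 * (r `^ beta / alpha + (alpha - 2) / (2 * alpha))) =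
    C * (a ^+ 2 * (t ^+ 2 * (r `^ beta / beta + (beta - 2) / (2 * beta)))).
  rewrite /b /beta; field.
  by rewrite !gt_eqF// subr_gt0.
rewrite ler_pM2l// ler_pM2l ?exprn_gt0//.
(* Tangent inequality for [u |-> u^(beta/2)] at [u = s^2], convex since [beta >= 2]. Working in the
   squared variable is what produces the factor [t^2]; it is used at [s = 1] and at [s = t r]. *)
have tan s : 0 < s -> s `^ beta + (beta / 2) * s `^ (beta - 2) * (r ^+ 2 - s ^+ 2) <= r `^ beta.
  move=> s0; have := @powR_tangent (beta / 2) (s ^+ 2) (r ^+ 2).
  rewrite -!powR_mulrn ?(ltW s0) ?(ltW r0)// -!powRrM.
  have -> : 2 * (beta / 2) = beta by field.
  have -> : 2 * (beta / 2 - 1) = beta - 2 by field.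
  apply; rewrite ?powR_gt0 ?powR_ge0//; lra.
rewrite /hh; case: ifPn => [tr1|].
  have := tan 1 ltr01; rewrite !powR1 expr1n => H.
  have -> : (t * r) ^+ 2 / 2 = t ^+ 2 * (r ^+ 2 / 2) by ring.
  rewrite ler_pM2l ?exprn_gt0//.
  have -> : r `^ beta / beta + (beta - 2) / (2 * beta) =
    (r `^ beta + (beta - 2) / 2) / beta by field; rewrite gt_eqF.
  by rewrite ler_pdivlMr//; lra.
rewrite -ltNge => tr1; have tr0 : 0 < t * r by lra.
have := tan (t * r) tr0.
have XE : (t * r) `^ beta = (t * r) ^+ 2 * (t * r) `^ (beta - 2).
  by rewrite -powR_mulrn ?(ltW tr0)// -powRD ?(gt_eqF tr0) ?implybT//; congr (_ `^ _); ring.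
have Y1 : 1 <= (t * r) `^ beta.
  by rewrite -[leLHS](p1 beta) ge0_ler_powR ?nnegrE ?(ltW tr0) ?(ltW tr1) ?(ltW beta0).
move=> H.
have t20 : 0 < t ^+ 2 by rewrite exprn_gt0.
have {}H : (t * r) `^ beta * (t ^+ 2 + beta / 2 * (1 - t ^+ 2)) <= t ^+ 2 * r `^ beta.
  move: H; rewrite -(ler_pM2l t20); apply: le_trans.
  rewrite XE le_eqVlt; apply/orP; left; apply/eqP.
  by set Y := (t * r) `^ (beta - 2); ring.
have t2 : t ^+ 2 <= 1 by rewrite expr_le1// ltW.
have -> : (t * r) `^ beta / beta + (beta - 2) / (2 * beta) =
    ((t * r) `^ beta + (beta - 2) / 2) / beta by field; rewrite gt_eqF.
have -> : t ^+ 2 * (r `^ beta / beta + (beta - 2) / (2 * beta)) =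
    (t ^+ 2 * r `^ beta + t ^+ 2 * ((beta - 2) / 2)) / beta by field; rewrite gt_eqF.
rewrite ler_pM2r ?invr_gt0//.
move: H Y1; set X := _ `^ beta; set Y := _ * _ `^ _; set T := t ^+ 2 in t2 t20 * => H Y1.
have : 0 <= (X - 1) * ((1 - T) * (beta - 2)).
  by rewrite mulr_ge0 ?subr_ge0// mulr_ge0 ?subr_ge0.
nra.
Qed.
End cost.

(** * Smooth functions *)

Section smoothness.
Context {R : realType}.

Lemma derive_line (V : normedModType R) (f : V -> R) x v :
  'D_v f x = 'D_1 (fun h : R => f (h *: v + x)) 0.
Proof.
rewrite /derive; set g1 := fun h => h^-1 *: _; set g2 := fun h => h^-1 *: _.
suff -> : g1 = g2 by [].
by rewrite funeqE /g1 /g2 => h /=; rewrite addr0 scale0r add0r [_%:A]mulr1.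
Qed.

(** Derivability along [v] does not make [g] differentiable, so the chain rule is applied to the
    restriction of [g] to the line through [x], where the two notions coincide. *)
Lemma is_derive_chain (V : normedModType R) (g : V -> R) (h : R -> R) x v dg dh :
  is_derive x v g dg -> is_derive (g x) 1 h dh ->
  is_derive x v (h \o g) (dh * dg).
Proof.
move=> [/derivable1P gd gE] [hd hE].
have g0 : g x = (fun s : R => g (s *: v + x)) 0 by rewrite scale0r add0r.
rewrite g0 in hd hE.
have hd' : differentiable h (g (0 *: v + x)) by exact/derivable1_diffP.
have gd' : differentiable (fun s : R => g (s *: v + x)) (0 : R).
  by move/derivable1_diffP : gd.
apply: DeriveDef.
  apply/derivable1P/derivable1_diffP.
  exact: (differentiable_comp gd' hd').
rewrite derive_line -derive1E.
rewrite [LHS](derive1_comp gd hd).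
by rewrite !derive1E hE -derive_line gE.
Qed.

Context {n : nat}.
Local Notation e_ i := (delta_mx 0 i : 'rV[R]_n).
Implicit Types f g : 'rV[R]_n -> R.

(** Finite-order form of [smooth], graded so that closure under products and compositions can be
    proved by induction on the order. *)
Fixpoint smoothN k f : Prop :=
  if k is k'.+1 then [/\ continuous f, forall i x, derivable f x (e_ i)
    & forall i, smoothN k' (partial i f)] else continuous f.

Lemma smoothNW k f : smoothN k.+1 f -> smoothN k f.
Proof.
elim: k f => [f []//|k ih f [cf df h]]; split => // i; exact: ih.
Qed.

Lemma smoothN_smooth f : (forall k, smoothN k f) -> smooth f.
Proof.
move=> h s; have {h} : forall k, smoothN k (foldr partial f s).
  by elim: s => //= i s ih k; have [_ _] := ih k.+1; exact.
by move=> h; split; [exact: (h 0%N)|move=> i x; have [_ + _] := h 1%N; exact].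
Qed.

Lemma partialE i f g : (forall x, is_derive x (e_ i) f (g x)) ->
  partial i f = g.
Proof. by move=> h; apply/funext => x; rewrite /partial derive_val. Qed.

Lemma smoothN_intro k f (g : 'I_n -> 'rV[R]_n -> R) :
  continuous f -> (forall i x, is_derive x (e_ i) f (g i x)) ->
  (forall i, smoothN k (g i)) -> smoothN k.+1 f.
Proof.
move=> cf h sg; split => // i.
by rewrite (partialE (h i)).
Qed.

Lemma smoothN_elim k f : smoothN k.+1 f ->
  [/\ continuous f, forall i x, is_derive x (e_ i) f (partial i f x)
    & forall i, smoothN k (partial i f)].
Proof. by move=> [cf df sf]; split => // i x; exact: derivableP. Qed.

Lemma smoothN_continuous k f : smoothN k f -> continuous f.
Proof. by case: k => [|k []]. Qed.

Lemma smoothN_cst k c : smoothN k (cst c).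
Proof.
elim: k c => [|k ih] c; first exact: cst_continuous.
apply: (@smoothN_intro _ _ (fun _ => cst 0)); first exact: cst_continuous.
- by move=> i; exact: ih.
Qed.

Lemma smoothND k f g : smoothN k f -> smoothN k g -> smoothN k (f + g).
Proof.
elim: k f g => [f g /= cf cg x|k ih f g]; first by exact: continuousD (cf x) (cg x).
move=> /smoothN_elim[cf df sf] /smoothN_elim[cg dg sg].
apply: (@smoothN_intro _ _ (fun i => partial i f + partial i g)).
- by move=> x; exact: continuousD (cf x) (cg x).
- by move=> i; apply: ih.
Qed.

Lemma smoothNM k f g : smoothN k f -> smoothN k g -> smoothN k (f * g).
Proof.
elim: k f g => [f g /= cf cg x|k ih f g]; first by exact: continuousM (cf x) (cg x).
move=> /[dup] Sf /smoothN_elim[cf df sf] /[dup] Sg /smoothN_elim[cg dg sg].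
apply: (@smoothN_intro _ _ (fun i => f * partial i g + g * partial i f)).
- by move=> x; exact: continuousM (cf x) (cg x).
- by move=> i; apply: smoothND; apply: ih => //; exact: smoothNW.
Qed.

Lemma smoothN_sum k (I : Type) (r : seq I) (F : I -> 'rV[R]_n -> R) :
  (forall i, smoothN k (F i)) -> smoothN k (fun x => \sum_(i <- r) F i x).
Proof.
move=> h; elim: r => [|i r ih].
  by under eq_fun do rewrite big_nil; exact: smoothN_cst.
by under eq_fun do rewrite big_cons; apply: (smoothND (h i) ih).
Qed.

(** [h'] is a function of the point, already composed with [f]: for [expR], the inverse and [ln] it
    is again built from [f], hence covered at the lower order. *)
Lemma smoothN_comp k f (h : R -> R) (h' : 'rV[R]_n -> R) :
  (forall x, is_derive (f x) 1 h (h' x)) -> smoothN k h' ->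
  smoothN k.+1 f -> smoothN k.+1 (h \o f).
Proof.
move=> dh sh' /[dup] Sf /smoothN_elim[cf df sf].
apply: (@smoothN_intro _ _ (fun i => h' * partial i f)).
- move=> x; apply: continuous_comp; first exact: cf.
  by apply/differentiable_continuous/derivable1_diffP; have [] := dh x.
- by move=> i x; apply: is_derive_chain.
- by move=> i; apply: smoothNM.
Qed.

Lemma smoothN_expR k f : smoothN k f -> smoothN k (expR \o f).
Proof.
elim: k f => [f /= cf x|k ih f sf]; first by apply: continuous_comp; [exact: cf|exact: continuous_expR].
apply: (@smoothN_comp _ _ _ (expR \o f)) => //.
by apply: ih; apply: smoothNW.
Qed.

Lemma smoothN_inv k f : (forall x, 0 < f x) -> smoothN k f ->
  smoothN k (GRing.inv \o f).
Proof.
move=> f0; elim: k => [/= cf x|k ih sf].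
  apply: continuous_comp; first exact: cf.
  by apply: inv_continuous; rewrite gt_eqF.
apply: (@smoothN_comp _ _ _ (cst (-1) * ((GRing.inv \o f) * (GRing.inv \o f)))) => //.
  move=> x; have fx : f x != 0 by rewrite gt_eqF.
  have /derivableP := @derivableV R R id (f x) 1 fx (@derivable_id _ _ _ _).
  rewrite (@deriveV R R id (f x) 1 fx (@derivable_id _ _ _ _)) derive_id.
  move=> h; apply: is_derive_eq; rewrite [LHS]mulr1 expr2 invfM /=.
  by rewrite [RHS]mulN1r.
have s := ih (smoothNW sf).
by apply: smoothNM; [exact: smoothN_cst|exact: smoothNM].
Qed.

Lemma smoothN_ln k f : (forall x, 0 < f x) -> smoothN k f ->
  smoothN k (@ln R \o f).
Proof.
move=> f0; case: k => [/= cf x|k sf].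
  by apply: continuous_comp; [exact: cf|exact: continuous_ln].
apply: (@smoothN_comp _ _ _ (GRing.inv \o f)) => //.
  by move=> x; exact: is_derive1_ln.
exact/smoothN_inv/smoothNW.
Qed.

Lemma is_derive_coord i j (x : 'rV[R]_n) :
  is_derive x (e_ i) (fun x : 'rV[R]_n => x 0 j) (i == j)%:R.
Proof.
apply: DeriveDef.
  by apply: diff_derivable; exact: differentiable_coord.
rewrite derive_line.
have -> : (fun h : R => (h *: e_ i + x) 0 j) = (fun h => h * (i == j)%:R + x 0 j).
  by apply/funext => h; rewrite !mxE eqxx/= eq_sym.
by rewrite derive_val; rewrite !scaler0 !add0r addr0 [LHS]mulr1.
Qed.

Lemma smoothN_coord k j : smoothN k (fun x : 'rV[R]_n => x 0 j).
Proof.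
have c : continuous (fun x : 'rV[R]_n => x 0 j) by exact: coord_continuous.
case: k => // k.
apply: (@smoothN_intro _ _ (fun i => cst (i == j)%:R)) => //.
  by move=> i x; exact: is_derive_coord.
by move=> i; exact: smoothN_cst.
Qed.

End smoothness.

(** * Smooth subsolutions of the Hamilton-Jacobi equation *)

Section harmonic_sum.
Context {R : realType} {J K : finType}.
Implicit Types (A : J -> K -> R) (j : J) (k : K).

Definition expsum A j : R := \sum_k expR (A j k).
(* [- ln (softS A)] is a soft version of [min_j max_k A j k]. *)
Definition softS A : R := \sum_j (expsum A j)^-1.
(* The derivative of [- ln (softS A)] with respect to [A j k]. *)
Definition softW A j k : R := expR (A j k) / expsum A j ^+ 2 / softS A.

Context (j0 : J) (k0 : K).

Lemma sumr_gt0 (I : finType) (i0 : I) (F : I -> R) :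
  (forall i, 0 < F i) -> 0 < \sum_i F i.
Proof.
move=> F0; rewrite (bigD1 i0)//= ltr_pwDl// sumr_ge0// => i _; exact: ltW.
Qed.

Lemma expsum_gt0 A j : 0 < expsum A j.
Proof. by apply: (sumr_gt0 k0) => k; exact: expR_gt0. Qed.

Lemma softS_gt0 A : 0 < softS A.
Proof. by apply: (sumr_gt0 j0) => j; rewrite invr_gt0 expsum_gt0. Qed.

Lemma softW_ge0 A j k : 0 <= softW A j k.
Proof. by rewrite !divr_ge0 ?expR_ge0 ?sqr_ge0// ltW// softS_gt0. Qed.

Lemma softW_sum A : \sum_j \sum_k softW A j k = 1.
Proof.
have S0 : softS A != 0 by rewrite gt_eqF ?softS_gt0.
under eq_bigr do rewrite -!mulr_suml.
rewrite -mulr_suml -[RHS](divff S0); congr (_ / _).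
apply: eq_bigr => j _; rewrite -/(expsum A j).
by have := expsum_gt0 A j; set z := expsum A j => z0; field; rewrite gt_eqF.
Qed.

(** The weights depend on the entries but not on the direction [v]. Taking [V] to be the time line
    or the space therefore gives averages with common weights. *)
Lemma is_derive_softS (V : normedModType R) (a : V -> J -> K -> R) (d : J -> K -> R) y v :
  (forall j k, is_derive y v (fun z => a z j k) (d j k)) ->
  is_derive y v (fun z => softS (a z))
   (- softS (a y) * \sum_j \sum_k softW (a y) j k * d j k).
Proof.
move=> da.
have dZ j : is_derive y v (fun z => expsum (a z) j) (\sum_k expR (a y j k) * d j k).
  rewrite /expsum.
  have : is_derive y v (\sum_k (expR \o (fun z => a z j k))) (\sum_k expR (a y j k) * d j k).
    elim/big_ind2: _ => [|f1 df1 f2 df2 h1 h2|k _].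
    - exact: is_derive_cst.
    - exact: is_deriveD.
    - by apply: is_derive_chain; exact: da.
  by rewrite (_ : \sum_k _ = (fun z => \sum_k expR (a z j k)))//; apply/funext => z; rewrite fct_sumE.
have dV j : is_derive y v (fun z => (expsum (a z) j)^-1)
    (- (expsum (a y) j) ^- 2 * \sum_k expR (a y j k) * d j k).
  have n0 : expsum (a y) j != 0 by rewrite gt_eqF ?expsum_gt0.
  have [d1 dE] := dZ j; apply: DeriveDef; first exact: derivableV.
  by rewrite deriveV// dE.
have : is_derive y v (\sum_j (fun z => (expsum (a z) j)^-1))
    (\sum_j (- (expsum (a y) j) ^- 2 * \sum_k expR (a y j k) * d j k)).
  elim/big_ind2: _ => [|f1 df1 f2 df2 h1 h2|j _].
  - exact: is_derive_cst.
  - exact: is_deriveD.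
  - exact: dV.
rewrite (_ : \sum_j _ = (fun z => softS (a z))); last first.
  by apply/funext => z; rewrite fct_sumE.
move=> h; apply: is_derive_eq.
rewrite mulr_sumr; apply: eq_bigr => j _; rewrite !mulr_sumr.
apply: eq_bigr => k _; rewrite /softW; field.
by rewrite !gt_eqF ?softS_gt0 ?expsum_gt0.
Qed.

End harmonic_sum.

Section subsolution.
Context {R : realType} {n : nat} {J K : finType}.
Variables (j0 : J) (k0 : K) (c h : J -> K -> R) (q : J -> K -> 'I_n -> R).

Definition aff (t : R) (x : 'rV[R]_n) (j : J) (k : K) : R :=
  c j k + \sum_l q j k l * x 0 l - t * h j k.

Lemma is_derive_aff_x t x l j k :
  is_derive x (delta_mx 0 l) (fun z => aff t z j k) (q j k l).
Proof.
have : is_derive x (delta_mx 0 l)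
    (cst (c j k) + \sum_m (cst (q j k m) * (fun x : 'rV[R]_n => x 0 m)) - cst (t * h j k))
   (0 + \sum_m (q j k m * (l == m)%:R) - 0).
  have ds : is_derive x (delta_mx 0 l) (\sum_m (cst (q j k m) * (fun x : 'rV[R]_n => x 0 m)))
     (\sum_m (q j k m * (l == m)%:R)).
    elim/big_ind2: _ => [|f1 df1 f2 df2 h1 h2|m _].
    - exact: is_derive_cst.
    - exact: is_deriveD.
    - have := is_derive_coord l m x => ?; apply: is_derive_eq.
      by rewrite scaler0 addr0.
  exact: is_deriveB.
rewrite (_ : _ - _ = (fun z => aff t z j k)); last first.
  by apply/funext => z; rewrite /aff !fctE fct_sumE.
move=> ?; apply: is_derive_eq; rewrite add0r subr0 (bigD1 l)//= eqxx mulr1 big1 ?addr0//.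
by move=> m ml; rewrite eq_sym (negbTE ml) mulr0.
Qed.

Lemma is_derive_aff_t (t : R) x j k :
  is_derive t 1 (fun s : R => aff s x j k) (- h j k).
Proof.
have dM : is_derive t 1 (id * cst (h j k) : R -> R) (t *: 0 + h j k *: 1).
  exact: (@is_deriveM R R id (cst (h j k)) t 1 1 0 (is_derive_id _ _) (is_derive_cst _ _ _)).
have dB := is_deriveB (is_derive_cst (c j k + \sum_l q j k l * x 0 l) t 1) dM.
by apply: is_derive_eq; rewrite scaler0 !add0r [_%:A]mulr1.
Qed.

Lemma smoothN_aff m t j k : smoothN m (fun x => aff t x j k).
Proof.
have s : smoothN m (fun x : 'rV[R]_n => \sum_l q j k l * x 0 l).
  apply: smoothN_sum => l.
  exact: (smoothNM (smoothN_cst m (q j k l)) (smoothN_coord m l)).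
exact: (smoothND (smoothND (smoothN_cst m (c j k)) s) (smoothN_cst m (- (t * h j k)))).
Qed.

Definition Saff t x := softS (aff t x).
Definition Waff t x := softW (aff t x).

Lemma smoothN_Saff m t : smoothN m (Saff t).
Proof.
apply: smoothN_sum => j.
apply: (@smoothN_inv _ _ m (fun x => expsum (aff t x) j)) => [x|].
  exact: expsum_gt0.
apply: smoothN_sum => k.
exact/(smoothN_expR (f := fun x => aff t x j k))/smoothN_aff.
Qed.

(** [theta] will be [4 / C] times the temperature, so that [Upot] is [k u] rather than [u]. *)
Definition Upot (theta t : R) x : R := - theta * ln (Saff t x).

Lemma smoothN_Upot m theta t r : smoothN m (fun x => expR (r * Upot theta t x)).
Proof.
apply: (@smoothN_expR _ _ _ (fun x => r * Upot theta t x)).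
apply: (smoothNM (smoothN_cst m r)).
apply: (smoothNM (smoothN_cst m (- theta))).
by apply: smoothN_ln; [move=> x; exact: softS_gt0|exact: smoothN_Saff].
Qed.

Definition Uh (x : 'rV[R]_n) t := \sum_j \sum_k Waff t x j k * h j k.

Lemma is_derive_Upot_t theta (t : R) x :
  is_derive t 1 (fun s : R => Upot theta s x) (- theta * Uh x t).
Proof.
have S0 : 0 < Saff t x by exact: softS_gt0.
have dS : is_derive t 1 (fun s : R => Saff s x) (Saff t x * Uh x t).
  have := is_derive_softS j0 k0 (fun j k => is_derive_aff_t t x j k).
  move=> ?; apply: is_derive_eq.
  rewrite mulNr -mulrN -sumrN; congr (_ * _); apply: eq_bigr => j _.
  by rewrite -sumrN; apply: eq_bigr => k _; rewrite mulrN opprK.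
have := is_derive_chain dS (is_derive1_ln S0); rewrite mulKf ?gt_eqF// => dl.
have : is_derive t 1 (cst (- theta) * (@ln R \o (fun s : R => Saff s x)))
   (- theta *: Uh x t + ln (Saff t x) *: 0) by exact: is_deriveM.
by move=> ?; apply: is_derive_eq; rewrite scaler0 addr0.
Qed.

Lemma is_derive_Upot_x theta t r x l :
  is_derive x (delta_mx 0 l) (fun x => expR (r * Upot theta t x))
   (expR (r * Upot theta t x) * (r * theta * \sum_j \sum_k Waff t x j k * q j k l)).
Proof.
have S0 : 0 < Saff t x by exact: softS_gt0.
have dS := is_derive_softS j0 k0 (fun j k => is_derive_aff_x t x l j k).
have := is_derive_chain dS (is_derive1_ln S0).
rewrite mulNr mulrN mulKf ?gt_eqF// => dl.
have dU : is_derive x (delta_mx 0 l) (cst (- (r * theta)) * (@ln R \o Saff t))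
   (- (r * theta) *: (- \sum_j \sum_k Waff t x j k * q j k l) + ln (Saff t x) *: 0).
  exact: is_deriveM.
have := is_derive_chain dU (is_derive_expR _).
have -> : expR \o (cst (- (r * theta)) * (@ln R \o Saff t)) = (fun x => expR (r * Upot theta t x)).
  by apply/funext => z /=; congr expR; rewrite /Upot mulrA mulrN.
move=> ?; apply: is_derive_eq.
rewrite scaler0 addr0; congr (expR _ * _); last by rewrite scalerN scaleNr opprK.
by rewrite /Upot mulrA mulrN.
Qed.

End subsolution.

(** * Monotonicity along the flow *)

Lemma continuous_measurable_borelRn (R : realType) (n : nat) (f : 'rV[R]_n -> R) :
  continuous f -> measurable_fun setT (f : borelRn R n -> R).
Proof.
move=> cf; apply: (measurability _ (measurable_realfun.RGenOInfty.measurableE R)).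
move=> _ [A [x ->] <-]; rewrite setTI; apply: sub_sigma_algebra.
by move/continuousP : cf; apply; exact: rray_open.
Qed.

Section bounded.
Context {d} {T : measurableType d} {R : realType}.
Variable mu : probability T R.
Implicit Types f g : T -> R.
Local Open Scope ring_scope.

Lemma bounded_integrable f (M : R) : measurable_fun setT f -> (forall x, `|f x| <= M) ->
  mu.-integrable setT (EFin \o f).
Proof.
move=> mf fM; apply: measurable_bounded_integrable => //.
  by rewrite (le_lt_trans (probability_le1 mu measurableT)) ?ltry.
by exists M; split; [exact: num_real|move=> m Mm x _; exact: le_trans (fM x) (ltW Mm)].
Qed.

Lemma bounded_integral f (M : R) : measurable_fun setT f -> (forall x, `|f x| <= M) ->
  (\int[mu]_x (f x)%:E = (\int[mu]_x f x)%R%:E)%E.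
Proof.
move=> mf fM; rewrite /Rintegral fineK//.
by apply: integrable_fin_num => //; exact: bounded_integrable mf fM.
Qed.

Lemma Rintegral_ge_cst f (M c : R) : measurable_fun setT f -> (forall x, `|f x| <= M) ->
  (forall x, c <= f x) -> c <= \int[mu]_x f x.
Proof.
move=> mf fM cf.
have -> : c = \int[mu]_x (cst c x).
  rewrite Rintegral_cst//= probability_setT mulr1//.
apply: le_Rintegral => //; last exact: bounded_integrable mf fM.
by apply: (@bounded_integrable _ `|c|).
Qed.

End bounded.

Section monotone_quotient.
Context {d} {T : measurableType d} {R : realType}.
Variables (mu : probability T R) (U U' : R -> T -> R) (M : R).
Hypothesis mU : forall t, measurable_fun setT (U t).
Hypothesis dU : forall (t : R) x, is_derive t 1 (fun s : R => U s x) (U' t x).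
Hypothesis UM : forall t x, `|U t x| <= M.
Hypothesis UM' : forall t x, `|U' t x| <= M.

Let E t x := expR (t * U t x).
Let E' t x := (t * U' t x + U t x) * E t x.
Let G t := \int[mu]_x E t x.

Let mE t : measurable_fun setT (E t).
Proof. by apply: measurableT_comp => //; exact: measurable_funM. Qed.

Let dE (t : R) x : is_derive t 1 (fun s : R => E s x) (E' t x).
Proof.
have dM : is_derive t 1 (id * (fun s => U s x) : R -> R) (t *: U' t x + U t x *: 1).
  exact: (@is_deriveM R R id (fun s => U s x) t 1 1 _ (is_derive_id _ _) (dU t x)).
have := is_derive_chain dM (is_derive_expR _).
move=> ?; apply: is_derive_eq.
by rewrite /E' [_%:A]mulr1 mulrC.
Qed.

(** The open interval has both 0 and 1 in its interior, where derivatives under the integral are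
    needed; [|t| <= 2] on it gives the domination. *)
Let EM (t : R) x : t \in `]-1, 2[ -> `|E t x| <= expR (2 * M).
Proof.
rewrite in_itv/= => /andP[t1 t2]; rewrite ger0_norm ?expR_ge0// ler_expR.
rewrite (le_trans (ler_norm _))// normrM ler_pM//.
by rewrite ler_norml; apply/andP; split; lra.
Qed.

Let E'M (t : R) x : t \in `]-1, 2[ -> `|E' t x| <= 3 * M * expR (2 * M).
Proof.
move=> tI; rewrite normrM ler_pM ?EM//.
have t2 : `|t| <= 2 by move: tI; rewrite in_itv/= ler_norml => /andP[? ?]; apply/andP; split; lra.
rewrite (le_trans (ler_normD _ _))// normrM.
have := UM t x; have := ler_pM (normr_ge0 t) (normr_ge0 (U' t x)) t2 (UM' t x); lra.
Qed.

Let dG (t : R) : t \in `]-1, 2[ -> is_derive t 1 G (\int[mu]_x E' t x).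
Proof.
move=> tI.
have tI' : `]-1, 2[%classic t by [].
have iE s : `]-1, 2[%classic s -> mu.-integrable setT (EFin \o E s).
  by move=> sI; apply: bounded_integrable (mE s) _ => x; exact: EM.
have iG : mu.-integrable setT (EFin \o cst (3 * M * expR (2 * M)) : T -> \bar R).
  exact: (@bounded_integrable _ _ _ _ _ `|3 * M * expR (2 * M)|).
have der s y : `]-1, 2[%classic s -> setT y -> derivable (E ^~ y) s 1.
  by move=> _ _; have [] := dE s y.
have pE s y : partial1of2 E s y = E' s y.
  by rewrite partial1of2E; have [_ ->] := dE s y.
have ub s y : `]-1, 2[%classic s -> setT y -> `|partial1of2 E s y| <= cst (3 * M * expR (2 * M)) y.
  by move=> sI _; rewrite pE; exact: E'M.
have M0 (y : T) : 0 <= cst (3 * M * expR (2 * M)) y.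
  exact: le_trans (E'M y tI).
apply: DeriveDef.
  exact: (derivable_under_integral measurableT tI' iE der M0 iG ub).
rewrite -derive1E (differentiation_under_integral measurableT tI' iE der M0 iG ub).
by apply: eq_Rintegral => x _; exact: pE.
Qed.

Let G_gt0 (t : R) : t \in `]-1, 2[ -> 0 < G t.
Proof.
move=> tI; apply: lt_le_trans (expR_gt0 (- (2 * M))) _.
apply: Rintegral_ge_cst (mE t) (fun x => EM x tI) _ => x.
rewrite ler_expR lerNl (le_trans (ler_norm _))// normrN normrM ler_pM//.
by move: tI; rewrite in_itv/= => /andP[t1 t2]; rewrite ler_norml; apply/andP; split; lra.
Qed.

(* [t G'(t) <= G(t) ln G(t)], i.e. [(ln G(t) / t)' <= 0]. *)
Hypothesis dissipation : forall t, 0 < t < 1 ->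
  t * \int[mu]_x ((t * U' t x + U t x) * expR (t * U t x)) <=
    (\int[mu]_x expR (t * U t x)) * ln (\int[mu]_x expR (t * U t x)).

Let dQ (t : R) : t \in `]0, 2[ -> is_derive t 1 (fun s : R => ln (G s) / s)
  ((t * (\int[mu]_x E' t x) - G t * ln (G t)) / (G t * t ^+ 2)).
Proof.
rewrite in_itv/= => /andP[t0 t2].
have tI : t \in `]-1, 2[ by rewrite in_itv/= t2 andbT; lra.
have G0 := G_gt0 tI.
have dl := is_derive_chain (dG tI) (is_derive1_ln G0).
have dV := @is_deriveV R id t 1 1 (_ : t != 0) (is_derive_id _ _).
have := is_deriveM dl (dV _); rewrite gt_eqF// => /(_ isT) dd.
rewrite (_ : (fun s : R => ln (G s) / s) = (@ln R \o G) * (fun y => (id y)^-1))//.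
apply: is_derive_eq; rewrite /GRing.scale/=; field.
by rewrite !gt_eqF.
Qed.

(** The quotient [ln (G t) / t] is nonincreasing on []0, 1]]. As [G 0 = 1], its limit at [0^'+] is
    the derivative of [ln G] at 0, that is the mean of [U 0]. *)
Lemma log_mgf_le_mean : ln (\int[mu]_x expR (U 1 x)) <= \int[mu]_x U 0 x.
Proof.
have Q1 : ln (\int[mu]_x expR (U 1 x)) = ln (G 1) / 1.
  by rewrite divr1; congr (ln _); apply: eq_Rintegral => x _; rewrite /E mul1r.
rewrite Q1.
have I0 : (0 : R) \in `]-1, 2[ by rewrite in_itv/= ltrN10 ltr0n.
have G0 : G 0 = 1.
  rewrite /G (_ : E 0 = cst 1); last by apply/funext => x; rewrite /E mul0r expR0.
  by rewrite Rintegral_cst//= probability_setT mul1r.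
have dl0 : is_derive (0 : R) 1 (@ln R \o G) (\int[mu]_x U 0 x).
  have := is_derive_chain (dG I0) (is_derive1_ln (G_gt0 I0)).
  rewrite G0 invr1 mul1r.
  have -> : (\int[mu]_x E' 0 x) = \int[mu]_x U 0 x; last exact.
  by apply: eq_Rintegral => x _; rewrite /E' /E !mul0r add0r expR0 mulr1.
have cl : h^-1 *: (ln (G (h *: 1 + 0)) - ln (G 0)) @[h --> 0^'+] --> \int[mu]_x U 0 x.
  have [d1 <-] := dl0; apply: cvg_dnbhs_at_right.
  exact: d1.
apply: (cvgr_to_ge cl).
near=> s.
have s0 : 0 < s by [].
have s1 : s < 1 by near: s; apply: nbhs_right_lt.
rewrite G0 ln1 subr0 [s *: 1]mulr1 addr0 -[leRHS]/(s^-1 * ln (G s)) [leRHS]mulrC.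
have I02 (t : R) : 0 < t -> t <= 1 -> t \in `]0, 2[.
  by move=> t0 t1; rewrite in_itv/= t0 (le_lt_trans t1)// ltr1n.
have cf : {within `[s, 1], continuous (fun s : R => ln (G s) / s)}.
  apply: derivable_within_continuous => t; rewrite in_itv/= => /andP[st t1].
  by have [] := dQ (I02 t (lt_le_trans s0 st) t1).
apply: (@ler0_derive1_le_cc R (fun s : R => ln (G s) / s) s 1) => //.
- move=> t; rewrite in_itv/= => /andP[st t1].
  by have [] := dQ (I02 t (lt_trans s0 st) (ltW t1)).
- move=> t; rewrite in_itv/= => /andP[st t1].
  have tI : t \in `]0, 2[ by exact: I02 (lt_trans s0 st) (ltW t1).
  rewrite derive1E; have [_ ->] := dQ tI.
  have := dissipation (_ : 0 < t < 1); rewrite t1 (lt_trans s0 st) => /(_ isT) h.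
  rewrite mulr_le0_ge0 ?subr_le0//.
  rewrite invr_ge0 mulr_ge0 ?sqr_ge0// ltW// G_gt0//.
  by rewrite in_itv/= (lt_trans (ltrN10 R) (lt_trans s0 st)) (lt_trans t1)// ltr1n.
- by rewrite in_itv/= lexx ltW.
- by rewrite in_itv/= lexx ltW.
- exact: ltW.
Unshelve. all: by end_near. Qed.

End monotone_quotient.

Section integral_aux.
Context {d} {T : measurableType d} {R : realType}.

Lemma ge0_le_integralT (mu : {measure set T -> \bar R}) (f g : T -> \bar R) :
  (forall x, 0 <= f x)%E -> (forall x, f x <= g x)%E ->
  (\int[mu]_x f x <= \int[mu]_x g x)%E.
Proof.
move=> f0 fg; have g0 x : (0 <= g x)%E by exact: le_trans (fg x).
rewrite !ge0_integralTE//; apply: le_ereal_sup => _ [h hf <-]; exists h => // x.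
exact: le_trans (fg x).
Qed.

Lemma bounded_Lfun2 (mu : probability T R) (f : T -> R) M :
  measurable_fun setT f -> (forall x, `|f x| <= M) -> f \in Lfun mu 2%:E.
Proof.
move=> mf fM; rewrite inE/=; apply/andP; split; rewrite inE//=.
rewrite /finite_norm unlock poweR_lty//.
under eq_integral do rewrite /= powR_mulrn//.
apply: integrable_lty => //.
apply: (@bounded_integrable _ _ _ mu (fun x => `|f x| ^+ 2) (M ^+ 2)).
  by apply: measurable_funX; exact: measurableT_comp.
move=> x; rewrite ger0_norm ?exprn_ge0// ler_sqr ?nnegrE//.
exact: le_trans (fM x).
Qed.

End integral_aux.

Lemma H1_ge0 (R : realType) (alpha a x : R) : 1 <= alpha <= 2 -> 0 < a ->
  (0 <= H1 a alpha x)%E.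
Proof.
move=> /andP[a1 a2] a0; rewrite /H1; case: ifPn => _.
  by rewrite lee_fin divr_ge0// sqr_ge0.
have [<-|a1'] := eqVneq 1 alpha; first by rewrite hoelder_conjugate1.
have {a1 a1'} a1 : 1 < alpha by rewrite lt_neqAle a1'.
rewrite hoelder_conjugate_gt1// lee_fin.
have b2 : 2 <= alpha / (alpha - 1) by rewrite ler_pdivlMr; lra.
set beta := alpha / _ in b2 *; have b0 : 0 < beta by lra.
apply: addr_ge0; apply: mulr_ge0; rewrite ?powR_ge0 ?sqr_ge0//.
  by rewrite divr_ge0 ?powR_ge0// ltW.
by rewrite divr_ge0 ?subr_ge0// mulr_ge0// ltW.
Qed.

Lemma H1e_ge0 (R : realType) (alpha a : R) x : 1 <= alpha <= 2 -> 0 < a ->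
  (0 <= H1e a alpha x)%E.
Proof. by move=> a12 a0; case: x => //= r; exact: H1_ge0. Qed.

(** * The logarithmic Sobolev inequality along the flow *)

Section hypercontractivity.
Context {R : realType} {n : nat} {J K : finType}.
Variables (j0 : J) (k0 : K) (c h : J -> K -> R) (q : J -> K -> 'I_n -> R).
Variables (a alpha C : R) (mu : probability (borelRn R n) R).
Hypotheses (halpha : 1 <= alpha <= 2) (ha : 0 < a) (hC : 0 < C).
Variable theta : R.
Hypothesis theta0 : 0 < theta.
Let b := a * C / 2.
Let eps := theta * C / 4.
(* [H (q j k) <= h j k] for [H] the conjugate of [L1 b alpha], up to the scaling [eps]. *)
Hypothesis subsol : forall j k (w : 'I_n -> R),
  \sum_l (eps * q j k l * w l - L1 b alpha (w l)) <= eps * h j k.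
Hypothesis slope : alpha = 1 -> forall j k l, `|eps * q j k l| <= b.
Hypothesis lsi : LSI a alpha C mu.
Hypotheses (qj0 : forall k l, q j0 k l = 0) (hj0 : forall k, h j0 k = 0).
Hypotheses (qk0 : forall j l, q j k0 l = 0) (hk0 : forall j, h j k0 = 0).

Local Notation S := (Saff c h q).
Local Notation W := (Waff c h q).
Local Notation U := (Upot c h q theta).
Local Notation V := (Uh c h q).

(** Row [j0] consists of constants, so one summand of [S] is a constant lower bound; each inner sum
    contains the constant entry of column [k0], which bounds its inverse above. *)
Lemma Saff_bounded : exists m M : R, 0 < m /\ forall t x, m <= S t x <= M.
Proof.
have aj t x k : aff c h q t x j0 k = c j0 k.
  by rewrite /aff hj0 mulr0 subr0 big1 ?addr0// => l _; rewrite qj0 mul0r.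
have ak t x j : aff c h q t x j k0 = c j k0.
  by rewrite /aff hk0 mulr0 subr0 big1 ?addr0// => l _; rewrite qk0 mul0r.
exists (\sum_k expR (c j0 k))^-1, (\sum_j (expR (c j k0))^-1); split.
  by rewrite invr_gt0; apply: (sumr_gt0 k0) => k; exact: expR_gt0.
move=> t x; apply/andP; split; rewrite /Saff /softS.
  rewrite (bigD1 j0)//= -[leLHS]addr0 lerD//.
    by rewrite /expsum; under eq_bigr do rewrite -(aj t x).
  by rewrite sumr_ge0// => j _; rewrite invr_ge0 ltW// expsum_gt0.
apply: ler_sum => j _; rewrite lef_pV2 ?posrE ?expR_gt0 ?expsum_gt0//.
rewrite /expsum (bigD1 k0)//= ak lerDl sumr_ge0// => k _; exact: expR_ge0.
Qed.

Lemma Uh_bounded : exists M : R, forall t x, `|V t x| <= M.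
Proof.
exists (\sum_j \sum_k `|h j k|) => x t.
apply: le_trans (ler_norm_sum _ _ _) _; apply: ler_sum => j _.
apply: le_trans (ler_norm_sum _ _ _) _; apply: ler_sum => k _.
rewrite normrM ger0_norm ?softW_ge0// ler_piMl//.
rewrite -(softW_sum j0 k0 (aff c h q t x)) (bigD1 j)//= (bigD1 k)//= -addrA.
rewrite lerDl addr_ge0// sumr_ge0// => i _; rewrite ?softW_ge0//.
by rewrite sumr_ge0// => i' _; rewrite softW_ge0.
Qed.

Lemma Upot_bounded : exists M : R, forall t x, `|U t x| <= M.
Proof.
have [m [M [m0 SM]]] := Saff_bounded.
exists (theta * (`|ln m| + `|ln M|)) => t x.
rewrite /Upot normrM normrN (gtr0_norm theta0) ler_pM2l//.
have /andP[mS SM'] := SM t x; have S0 : 0 < S t x by exact: lt_le_trans mS.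
have l1 : ln m <= ln (S t x) by rewrite ler_ln.
have l2 : ln (S t x) <= ln M by rewrite ler_ln// posrE (lt_le_trans S0).
rewrite ler_norml.
have := ler_norm (ln M); have := ler_norm (- ln m); rewrite normrN => ? ?.
have := normr_ge0 (ln M); have := normr_ge0 (ln m) => ? ?.
apply/andP; split; lra.
Qed.

Lemma measurable_expUpot t r : measurable_fun setT (fun x : borelRn R n => expR (r * U t x)).
Proof.
apply: continuous_measurable_borelRn.
exact: (smoothN_continuous (smoothN_Upot j0 k0 c h q 0 theta t r)).
Qed.

Lemma measurable_Upot t : measurable_fun setT (U t : borelRn R n -> R).
Proof.
apply: continuous_measurable_borelRn.
apply: (smoothN_continuous (k := 0)).
apply: (smoothNM (smoothN_cst 0 (- theta))).
apply: smoothN_ln; last exact: (smoothN_Saff k0).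
by move=> x; exact: softS_gt0.
Qed.

Lemma measurable_Uh t : measurable_fun setT (V ^~ t : borelRn R n -> R).
Proof.
apply: continuous_measurable_borelRn.
apply: (smoothN_continuous (k := 0)).
have sZ j : smoothN 0 (fun x => expsum (aff c h q t x) j).
  apply: smoothN_sum => k.
  exact/(smoothN_expR (f := fun x => aff c h q t x j k))/smoothN_aff.
apply: smoothN_sum => j; apply: smoothN_sum => k.
apply: (smoothNM (f := fun x => W t x j k) (g := cst (h j k))); last exact: smoothN_cst.
have -> : (fun x => W t x j k) = (expR \o (fun x => aff c h q t x j k)) *
    ((GRing.inv \o (fun x => expsum (aff c h q t x) j)) *
     (GRing.inv \o (fun x => expsum (aff c h q t x) j)) * (GRing.inv \o S t)).
  by apply/funext => x; rewrite /Waff /softW /= expr2 invfM -!mulrA.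
apply: smoothNM; first exact/smoothN_expR/smoothN_aff.
apply: smoothNM; last first.
  by apply: smoothN_inv; [move=> x; exact: softS_gt0|exact: (smoothN_Saff k0)].
by apply: smoothNM; apply: smoothN_inv => // x; exact: expsum_gt0.
Qed.

(** Jensen's inequality for the conjugate: the maximiser [w] at the averaged slope [p] is tested in
    [subsol] at every [(j, k)], and [p w - L1 w] is affine in [p]. The exponential never vanishes,
    so [equot] is here a true logarithmic derivative. *)
Lemma Hgrad_le t x : 0 < t <= 1 ->
  (Hgrad a alpha (fun x => expR (t / 2 * U t x)) x <= (t ^+ 2 / C * (theta * V x t))%:E)%E.
Proof.
move=> t01.
pose p l := \sum_j \sum_k W t x j k * (eps * q j k l).
have W1 : \sum_j \sum_k W t x j k = 1 by exact: softW_sum.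
have W0 j k : 0 <= W t x j k by exact: softW_ge0.
have pE l : t / 2 * theta * (\sum_j \sum_k W t x j k * q j k l) = 2 * t / C * p l.
  rewrite /p !mulr_sumr; apply: eq_bigr => j _; rewrite !mulr_sumr.
  by apply: eq_bigr => k _; rewrite /eps; field; rewrite gt_eqF.
have pb l : alpha = 1 -> `|p l| <= a * C / 2.
  move=> /slope sl; rewrite -[leRHS]mul1r -[X in _ <= X * _]W1 mulr_suml.
  apply: le_trans (ler_norm_sum _ _ _) _; apply: ler_sum => j _.
  rewrite mulr_suml.
  apply: le_trans (ler_norm_sum _ _ _) _; apply: ler_sum => k _.
  by rewrite normrM (ger0_norm (W0 j k)) ler_wpM2l ?W0 ?(sl j k l).
have /choice[hw Hhw] : forall l, exists hw : R * R, H1 a alpha (2 * t / C * p l) = hw.1%:E /\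
    C * hw.1 <= 4 * t ^+ 2 / C * (p l * hw.2 - L1 b alpha hw.2).
  move=> l; have [h' [w' [? ?]]] := H1_scaling halpha ha hC t01 (pb l).
  by exists (h', w').
have -> : Hgrad a alpha (fun x => expR (t / 2 * U t x)) x = (\sum_l (hw l).1)%:E.
  rewrite /Hgrad -sumEFin; apply: eq_bigr => l _; rewrite /equot gt_eqF ?expR_gt0//=.
  rewrite -(Hhw l).1; congr H1.
  have [_ dE] := is_derive_Upot_x j0 k0 c h q theta t (t / 2) x l.
  rewrite /partial dE mulrAC divff ?mul1r//; last by rewrite gt_eqF ?expR_gt0.
rewrite lee_fin -(ler_pM2l hC).
have -> : C * (t ^+ 2 / C * (theta * V x t)) = 4 * t ^+ 2 / C * (eps * V x t).
  by rewrite /eps; field; rewrite gt_eqF.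
rewrite mulr_sumr; apply: le_trans (ler_sum _ (fun l _ => (Hhw l).2)) _.
rewrite -mulr_sumr ler_wpM2l//.
  by apply: divr_ge0; [apply: mulr_ge0 => //; exact: sqr_ge0|exact: ltW].
apply: le_trans (_ : _ <= \sum_j \sum_k W t x j k *
    \sum_l (eps * q j k l * (hw l).2 - L1 b alpha (hw l).2)) _; last first.
  rewrite /Uh mulr_sumr; apply: ler_sum => j _.
  rewrite mulr_sumr; apply: ler_sum => k _.
  by rewrite mulrCA ler_wpM2l.
rewrite le_eqVlt; apply/orP; left; apply/eqP.
under [RHS]eq_bigr do under eq_bigr do rewrite mulr_sumr.
under [RHS]eq_bigr do rewrite exchange_big/=.
rewrite exchange_big/=; apply: eq_bigr => l _.
rewrite -{1}[L1 _ _ _]mul1r -W1 /p !mulr_suml -sumrB; apply: eq_bigr => j _.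
rewrite !mulr_suml -sumrB; apply: eq_bigr => k _.
by rewrite mulrBr !mulrA.
Qed.

Lemma log_mgf_le_meanU : ln (\int[mu]_x expR (U 1 x)) <= \int[mu]_x U 0 x.
Proof.
have [M1 UM] := Upot_bounded; have [M2 VM] := Uh_bounded.
pose M := `|M1| + theta * `|M2|.
have UM' t x : `|U t x| <= M.
  apply: le_trans (UM t x) _; apply: le_trans (ler_norm _) _.
  by rewrite lerDl mulr_ge0// ltW.
have VM' x t : `|- theta * V x t| <= M.
  rewrite normrM normrN (gtr0_norm theta0).
  apply: (@le_trans _ _ (theta * `|M2|)).
    by rewrite ler_pM2l// (le_trans (VM _ _))// ler_norm.
  by rewrite lerDr.
apply: (@log_mgf_le_mean _ _ _ mu U (fun t x => - theta * V x t) M) => //.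
- exact: measurable_Upot.
- by move=> t x; exact: is_derive_Upot_t.
move=> t /andP[t0 t1].
set E := fun x : borelRn R n => expR (t * U t x).
have mE : measurable_fun setT E by exact: measurable_expUpot.
have mU := measurable_Upot t.
have mV := measurable_Uh t.
have EM x : `|E x| <= expR M.
  rewrite ger0_norm ?expR_ge0// ler_expR (le_trans (ler_norm _))// normrM.
  by rewrite gtr0_norm// (le_trans _ (UM' t x))// ler_piMl// ltW.
have eM0 := expR_ge0 M.
have M0 : 0 <= M by apply: le_trans (UM' 0 0).
set G := \int[mu]_x E x.
have iE : mu.-integrable setT (EFin \o E) by exact: bounded_integrable mE EM.
(* [F1] is the entropy integrand of [E = f^2], and [t^2 / C * F2] dominates the integrand on the
   right of [LSI]. *)
pose F1 (x : borelRn R n) := E x * (t * U t x - ln G).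
pose F2 (x : borelRn R n) := theta * V x t * E x.
have mF1 : measurable_fun setT F1.
  by apply: measurable_funM => //; apply: measurable_funB => //; exact: measurable_funM.
have mF2 : measurable_fun setT F2.
  by apply: measurable_funM => //; exact: measurable_funM.
have F1M x : `|F1 x| <= expR M * (M + `|ln G|).
  rewrite normrM ler_pM//; apply: le_trans (ler_normB _ _) _; rewrite lerD2r.
  by rewrite normrM gtr0_norm// (le_trans _ (UM' t x))// ler_piMl// ltW.
have F2M x : `|F2 x| <= M * expR M.
  by rewrite normrM ler_pM//; have := VM' x t; rewrite mulNr normrN.
have iF1 := bounded_integrable mu mF1 F1M.
have iF2 := bounded_integrable mu mF2 F2M.
have key : \int[mu]_x F1 x <= t ^+ 2 * \int[mu]_x F2 x.
  pose f (x : borelRn R n) := expR (t / 2 * U t x).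
  have fE x : f x ^+ 2 = E x.
    by rewrite expr2 -expRD; congr expR; field.
  have mf : measurable_fun setT f by exact: measurable_expUpot.
  have fM x : `|f x| <= expR M.
    rewrite ger0_norm ?expR_ge0// ler_expR (le_trans (ler_norm _))// normrM.
    rewrite gtr0_norm ?divr_gt0// (le_trans _ (UM' t x))// ler_piMl//; lra.
  have sf : smooth f by apply: smoothN_smooth => k; exact: smoothN_Upot.
  have := lsi sf (bounded_Lfun2 mu mf fM).
  have -> : Ent mu (fun x => f x ^+ 2) = (\int[mu]_x F1 x)%R%:E.
    rewrite -(bounded_integral mu mF1 F1M) /Ent; apply: eq_integral => x _.
    rewrite (_ : (fun x => f x ^+ 2) = E); last by apply/funext.
    have G0 : 0 < G.
      apply: lt_le_trans (expR_gt0 (- M)) _; apply: (Rintegral_ge_cst mu mE EM) _ => y.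
      rewrite ler_expR lerNl (le_trans (ler_norm _))// normrN normrM.
      by rewrite gtr0_norm// (le_trans _ (UM' t y))// ler_piMl// ltW.
    by rewrite -/G fE ln_div ?posrE ?expR_gt0// expRK.
  move=> /le_trans => /(_ (t ^+ 2 * \int[mu]_x F2 x)%:E); rewrite lee_fin; apply.
  have -> : t ^+ 2 * (\int[mu]_x F2 x) = C * \int[mu]_x (t ^+ 2 / C * F2 x).
    by rewrite RintegralZl//; field; rewrite gt_eqF.
  rewrite EFinM lee_pmul2l//.
  have mF3 : measurable_fun setT (fun x => t ^+ 2 / C * F2 x) by exact: measurable_funM.
  have F3M x : `|t ^+ 2 / C * F2 x| <= `|t ^+ 2 / C| * (M * expR M).
    by rewrite normrM ler_wpM2l.
  rewrite -(bounded_integral mu mF3 F3M).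
  apply: ge0_le_integralT => x.
    rewrite mule_ge0 ?lee_fin ?sqr_ge0// sume_ge0// => l _; exact: H1e_ge0.
  rewrite fE /F2 [X in (_ <= X)%E](_ : _ = (t ^+ 2 / C * (theta * V x t))%:E * (E x)%:E)%E.
    by rewrite lee_wpmul2r ?lee_fin ?expR_ge0//; apply: Hgrad_le; rewrite t0 ltW.
  by rewrite -EFinM; congr EFin; ring.
rewrite -RintegralZl//; last first.
  apply: (@bounded_integrable _ _ _ _ _ ((M + M) * expR M)).
    apply: measurable_funM => //; apply: measurable_funD => //.
    by apply: measurable_funM => //; apply: measurable_funM.
  move=> x; rewrite normrM; apply: ler_pM => //; last exact: EM.
  apply: le_trans (ler_normD _ _) _.
  by rewrite lerD// normrM gtr0_norm// (le_trans _ (VM' x t))// ler_piMl// ltW.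
(* Since the time derivative of [U] is [- theta * V], the dissipation integrand is the difference
   controlled by [key] plus [ln G * E], whose integral is [G ln G]. *)
rewrite (_ : \int[mu]_x _ = \int[mu]_x (F1 x - t ^+ 2 * F2 x + ln G * E x)); last first.
  by apply: eq_Rintegral => x _; rewrite /F1 /F2 -/(E x); ring.
have iF2' : mu.-integrable setT (EFin \o (fun x => t ^+ 2 * F2 x)).
  exact: (integrableZl measurableT (t ^+ 2) iF2).
have iE' : mu.-integrable setT (EFin \o (fun x => ln G * E x)).
  exact: (integrableZl measurableT (ln G) iE).
rewrite RintegralD//; last exact: (integrableB measurableT iF1 iF2').
rewrite RintegralB// !RintegralZl// -/G.
by rewrite [ln G * G]mulrC gerDr subr_le0.
Qed.

End hypercontractivity.

(** * Duality *)

(** Legendre duality between [x ln x - x] and [expR], obtained from [1 + s <= expR s] at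
    [s = v - ln x]. *)
Lemma xlnx_young (R : realType) (x v : R) : 0 <= x ->
  x * v <= x * ln x - x + expR v.
Proof.
rewrite le_eqVlt => /predU1P[<-|x0].
  by rewrite !mul0r subr0 add0r expR_ge0.
have H := expR_ge1Dx (v - ln x).
have -> : expR v = x * expR (v - ln x).
  by rewrite expRD expRN lnK ?posrE// mulrCA divff ?gt_eqF// mulr1.
have := ler_wpM2l (ltW x0) H; nra.
Qed.

Section gibbs.
Context {d} {T : measurableType d} {R : realType}.
Variables (mu : probability T R) (F : T -> R).
Hypotheses (mF : measurable_fun setT F) (F0 : forall x, 0 <= F x).
Hypothesis F1 : (\int[mu]_x (F x)%:E = 1)%E.

Lemma density_integrable : mu.-integrable setT (EFin \o F).
Proof.
apply/integrableP; split; first exact/measurable_EFinP.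
under eq_integral do rewrite /= ger0_norm//.
by rewrite F1 ltry.
Qed.

Lemma density_mul_integrable (g : T -> R) (M : R) :
  measurable_fun setT g -> (forall x, `|g x| <= M) ->
  mu.-integrable setT (EFin \o (fun x => F x * g x)).
Proof.
move=> mg gM.
apply: (@le_integrable _ _ _ mu setT measurableT _ (fun x => M%:E * (F x)%:E)%E).
- by apply/measurable_EFinP; exact: measurable_funM.
- move=> x _ /=; rewrite lee_fin !normrM mulrC ler_wpM2r//.
  exact: le_trans (gM x) (ler_norm _).
- exact: (integrableZl measurableT M density_integrable).
Qed.

Let f x := (F x * ln (F x))%:E.

Let mf : measurable_fun setT f.
Proof.
apply/measurable_EFinP; apply: measurable_funM => //.
exact: measurableT_comp.
Qed.

Let neg_lty : (\int[mu]_x (f^\- x)%E < +oo)%E.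
Proof.
have f1 x : (- 1%:E <= f x)%E.
  rewrite lee_fin; have := @xlnx_young _ (F x) 0 (F0 x).
  rewrite mulr0 expR0; have := F0 x; move: (F x) => y.
  move=> y0 h.
  have [yb|] := lerP y 2; first lra.
  by move=> y2; have := @ln_gt0 _ y; nra.
apply: (@le_lt_trans _ _ (\int[mu]_x cst 1%:E x)%E).
  apply: ge0_le_integralT => x; first exact: funeneg_ge0.
  by rewrite funenegE ge_max lee01 andbT leeNl.
by rewrite integral_cst//= probability_setT mul1e ltry.
Qed.

Let neg_ge0 : (0 <= \int[mu]_x (f^\- x)%E)%E.
Proof. exact: integral_ge0. Qed.

(** [x ln x >= x - 1 >= -1], so the negative part has integral at most 1. *)
Lemma density_entropy_gtNy : (-oo < \int[mu]_x (F x * ln (F x))%:E)%E.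
Proof.
rewrite integralE -/f.
have : (0 <= \int[mu]_x (f^\+ x)%E)%E by exact: integral_ge0.
move: neg_lty neg_ge0.
set A := (\int[mu]_x (f^\+ x))%E; set B := (\int[mu]_x (f^\- x))%E.
by case: A => [A| |]; case: B => [B| |] //= _ _ _; rewrite ltNyr.
Qed.

Variable r : R.
Hypothesis entF : (\int[mu]_x (F x * ln (F x))%:E = r%:E)%E.

Lemma density_entropy_integrable :
  mu.-integrable setT (EFin \o (fun x => F x * ln (F x))).
Proof.
apply/integrableP; split => //.
rewrite [X in (X < _)%E](_ : _ = \int[mu]_x ((f^\+ \+ f^\-)%E x))%E; last first.
  by rewrite -fune_abse.
rewrite ge0_integralD//; [|exact: measurable_funepos|exact: measurable_funeneg].
rewrite lte_add_pinfty//.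
have E : (\int[mu]_x f x = r%:E)%E by exact: entF.
rewrite integralE in E; move: E neg_lty neg_ge0.
set A := (\int[mu]_x (f^\+ x))%E; set B := (\int[mu]_x (f^\- x))%E.
by case: A => [A| |]; case: B => [B| |] //= _ _ _; rewrite ltry.
Qed.

(** [xlnx_young] with [v = u - ln G], integrated: after this normalisation the terms [- F] and
    [expR u / G] have integrals [-1] and [1] and cancel. *)
Lemma gibbs (u : T -> R) (M : R) : measurable_fun setT u -> (forall x, `|u x| <= M) ->
  \int[mu]_x (F x * u x) <= r + ln (\int[mu]_x expR (u x)).
Proof.
move=> mu' uM.
have mE : measurable_fun setT (fun x => expR (u x)) by exact: measurableT_comp.
have EM x : `|expR (u x)| <= expR M.
  by rewrite ger0_norm ?expR_ge0// ler_expR (le_trans (ler_norm _)).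
set G := \int[mu]_x expR (u x).
have G0 : 0 < G.
  apply: lt_le_trans (expR_gt0 (- M)) _; apply: (Rintegral_ge_cst mu mE EM) => y.
  by rewrite ler_expR lerNl (le_trans (ler_norm _))// normrN.
have iE := bounded_integrable mu mE EM.
have iF := density_integrable.
have iFu := density_mul_integrable mu' uM.
have iFl := density_entropy_integrable.
have rE : \int[mu]_x (F x * ln (F x)) = r by rewrite /Rintegral entF.
have F1' : \int[mu]_x F x = 1 by rewrite /Rintegral F1.
have iFA : mu.-integrable setT (EFin \o (fun x => ln G * F x)).
  exact: (integrableZl measurableT (ln G) iF).
have iEG : mu.-integrable setT (EFin \o (fun x => G^-1 * expR (u x))).
  exact: (integrableZl measurableT G^-1 iE).
have : \int[mu]_x (F x * u x - ln G * F x) <=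
       \int[mu]_x (F x * ln (F x) - F x + G^-1 * expR (u x)).
  apply: le_Rintegral => //.
  - exact: (integrableB measurableT iFu iFA).
  - exact: (integrableD measurableT (integrableB measurableT iFl iF) iEG).
  move=> x _; have := xlnx_young (u x - ln G) (F0 x).
  by rewrite expRD expRN lnK// [_ / G]mulrC mulrBr [F x * ln G]mulrC.
rewrite RintegralB// RintegralD//; last exact: (integrableB measurableT iFl iF).
rewrite RintegralB// !RintegralZl// rE F1' -/G mulVf ?gt_eqF//; lra.
Qed.

End gibbs.

Lemma dL1_le1 (R : realType) (b z : R) : 0 < b -> `|dL1 b 1 z| <= b.
Proof.
move=> b0; rewrite /dL1; case: ifPn => // _.
rewrite subrr powRr0 mulr1 (_ : 2 - 1 = 1); last by ring.
rewrite powRr1 ?(ltW b0)// normrM (gtr0_norm b0) normr_sg ler_piMl ?(ltW b0)//.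
by case: (z != 0).
Qed.

Lemma idx_indicE (R : realType) (T : Type) (N : nat) (idx : T -> 'I_N) (g : 'I_N -> R) :
  g \o idx = (fun x => \sum_i g i * \1_(idx @^-1` [set i]) x).
Proof.
apply/funext => x /=; rewrite (bigD1 (idx x))//= big1 ?addr0 => [|i ix].
  by rewrite indicE mem_set ?mulr1.
by rewrite indicE memNset ?mulr0// => /= xi; rewrite xi eqxx in ix.
Qed.

Section duality.
Context {R : realType} {n : nat}.
Variables (a alpha C : R) (mu : probability (borelRn R n) R).
Hypotheses (halpha : 1 <= alpha <= 2) (ha : 0 < a) (hC : 0 < C).
Hypothesis lsi : LSI a alpha C mu.
Let b := a * C / 2.
Variables (N : nat) (y : 'I_N.+1 -> 'rV[R]_n) (idx : borelRn R n -> 'I_N.+1) (delta : R).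
Hypothesis midx : forall i, measurable (idx @^-1` [set i]).
Hypothesis idx_near : forall x, idx x != ord_max ->
  forall l, `|x 0 l - y (idx x) 0 l| <= delta.

(* A lower bound for the cost between the cells of [y i] and [y j], free of charge
   for the remainder cell [ord_max]. *)
Definition cell_cost (i j : 'I_N.+1) : R :=
  if (i == ord_max) || (j == ord_max) then 0 else
  Num.max 0 (\sum_l (L1 b alpha (y i 0 l - y j 0 l) -
                     2 * delta * `|dL1 b alpha (y i 0 l - y j 0 l)|)).

Variables (F : borelRn R n -> R) (r : R).
Hypotheses (mF : measurable_fun setT F) (F0 : forall x, 0 <= F x).
Hypothesis F1 : (\int[mu]_x (F x)%:E = 1)%E.
Hypothesis entF : (\int[mu]_x (F x * ln (F x))%:E = r%:E)%E.

(** In the Hopf-Lax formula [t L(z/t)] is the supremum of [p z - t H(p)]. The slopes [p] are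
    restricted to the gradients [Q k j] of the cost at [y k - y j]; [P k j] is [H (Q k j)], by the
    equality case of Legendre's inequality. *)
Let Q (k j : 'I_N.+1) (l : 'I_n) : R :=
  if (k == ord_max) || (j == ord_max) then 0
  else dL1 b alpha (y k 0 l - y j 0 l).
Let P (k j : 'I_N.+1) : R :=
  if (k == ord_max) || (j == ord_max) then 0
  else \sum_l (Q k j l * (y k 0 l - y j 0 l) - L1 b alpha (y k 0 l - y j 0 l)).

Variables (phi psi : 'I_N.+1 -> R).
Hypothesis dual : forall i j, phi i + psi j <= cell_cost i j.

Lemma measurable_idx (g : 'I_N.+1 -> R) : measurable_fun setT (g \o idx).
Proof.
rewrite idx_indicE; apply: measurable_sum => i.
by apply: measurable_funM => //; exact: measurable_indic.
Qed.

Lemma idx_bounded (g : 'I_N.+1 -> R) x : `|(g \o idx) x| <= \sum_i `|g i|.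
Proof. by rewrite /= (bigD1 (idx x))//= lerDl sumr_ge0. Qed.

Let b0 : 0 < b. Proof. by rewrite divr_gt0// mulr_gt0. Qed.

Section smoothing.
Variable e : R.
Hypothesis e0 : 0 < e.
Let theta := 4 * e / C.
Let lnN : R := ln N.+1%:R.
(** The term in [delta] keeps each affine function below [- psi j] at time 0 on the whole cell of
    [y j]. Subtracting [lnN] turns the inner sum of [N.+1] exponentials into an average, so that
    [U0_le] holds without loss. *)
Let cc (j k : 'I_N.+1) : R := (- psi j - \sum_l (Q k j l * y j 0 l) - \sum_l delta * `|Q k j l|) / e - lnN.
Let qq j k l := Q k j l / e.
Let hh j k := P k j / e.
Let U := Upot cc hh qq theta.

Let theta0 : 0 < theta. Proof. by rewrite divr_gt0// mulr_gt0. Qed.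

Let epsE : theta * C / 4 = e.
Proof. by rewrite /theta; field; rewrite gt_eqF. Qed.

Let affE t x j k : aff cc hh qq t x j k =
  (- psi j + \sum_l (Q k j l * (x 0 l - y j 0 l) - delta * `|Q k j l|) - t * P k j) / e - lnN.
Proof.
rewrite /aff /cc /hh /qq.
have -> : \sum_l Q k j l / e * x 0 l = (\sum_l Q k j l * x 0 l) / e.
  by rewrite mulr_suml; apply: eq_bigr => l _; rewrite mulrAC.
have -> : \sum_l (Q k j l * (x 0 l - y j 0 l) - delta * `|Q k j l|) =
  \sum_l Q k j l * x 0 l - \sum_l Q k j l * y j 0 l - \sum_l delta * `|Q k j l|.
  by rewrite -!sumrB; apply: eq_bigr => l _; rewrite mulrBr.
by field; rewrite gt_eqF.
Qed.

Let lnN_exp : expR lnN = N.+1%:R.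
Proof. by rewrite /lnN lnK// posrE ltr0n. Qed.

Let U0_le x : U 0 x <= 4 / C * - psi (idx x).
Proof.
set j := idx x; rewrite /U /Upot.
have S0 : 0 < Saff cc hh qq 0 x by exact: (softS_gt0 ord_max ord_max).
have h : expR (psi j / e) <= Saff cc hh qq 0 x.
  rewrite /Saff /softS (bigD1 j)//= -[leLHS]addr0 lerD//; last first.
    by apply: sumr_ge0 => i _; rewrite invr_ge0 ltW// (expsum_gt0 ord_max).
  rewrite -[psi j / e]opprK expRN lef_pV2 ?posrE ?expR_gt0 ?(expsum_gt0 ord_max)//.
  apply: le_trans (_ : _ <= \sum_(k < N.+1) expR (- (psi j / e) - lnN)) _.
    apply: ler_sum => k _; rewrite ler_expR affE mul0r subr0 lerD2r.
    rewrite -mulNr ler_pM2r ?invr_gt0// gerDl.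
    rewrite -oppr_ge0 -sumrN; apply: sumr_ge0 => l _; rewrite opprB subr_ge0.
    have [jm|jm] := eqVneq j ord_max.
      by rewrite /Q jm eqxx orbT normr0 !mul0r mulr0.
    rewrite (le_trans (ler_norm _))// normrM mulrC ler_wpM2r//.
    exact: idx_near.
  rewrite sumr_const card_ord -[leLHS]mulr_natl -lnN_exp -expRD.
  by rewrite ler_expR; lra.
have : psi j / e <= ln (Saff cc hh qq 0 x).
  by rewrite -[leLHS]expRK ler_ln// posrE expR_gt0.
move=> h'; have -> : 4 / C * - psi j = - theta * (psi j / e).
  by rewrite /theta; field; rewrite !gt_eqF.
by rewrite !mulNr lerN2 ler_pM2l.
Qed.

(** The slope [k = i] contributes [L1 (y i - y j) + Q (x - y i)], summed over coordinates. The
    position of [x] in its cell and the slack in [cc] cost [delta * |Q|] each, whence the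
    [2 * delta] of [cell_cost]; the slope 0 of [k = ord_max] covers its [Num.max 0] and the
    remainder cell. One [lnN] comes from averaging over [k], one from summing over [j]. *)
Let U1_ge x : 4 / C * phi (idx x) - 2 * theta * lnN <= U 1 x.
Proof.
set i := idx x; rewrite /U /Upot.
have S0 : 0 < Saff cc hh qq 1 x by exact: (softS_gt0 ord_max ord_max).
have Qm j k l : (k == ord_max) || (j == ord_max) -> Q k j l = 0 by rewrite /Q => ->.
have Pm j k : (k == ord_max) || (j == ord_max) -> P k j = 0 by rewrite /P => ->.
have big j k : aff cc hh qq 1 x j k <= ln (expsum (aff cc hh qq 1 x) j).
  rewrite -[leLHS]expRK ler_ln ?posrE ?expR_gt0 ?(expsum_gt0 ord_max)//.
  by rewrite /expsum (bigD1 k)//= lerDl sumr_ge0// => k' _; exact: expR_ge0.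
have zero j k : (k == ord_max) || (j == ord_max) ->
    aff cc hh qq 1 x j k = - psi j / e - lnN.
  move=> kj; rewrite affE Pm// mulr0 subr0 big1 ?addr0// => l _.
  by rewrite Qm// normr0 mul0r mulr0 subr0.
have hZ j : phi i / e - lnN <= ln (expsum (aff cc hh qq 1 x) j).
  have cost0 : - psi j / e - lnN <= ln (expsum (aff cc hh qq 1 x) j).
    by rewrite -(zero j ord_max) ?eqxx.
  have := dual i j; rewrite /cell_cost; case: ifPn => [ij h|ij].
    apply: le_trans cost0; rewrite lerD2r ler_pM2r ?invr_gt0//; lra.
  rewrite -lerBrDr => /le_trans.
  rewrite /Num.max; case: ifPn => _ h; last first.
    by apply: le_trans cost0; rewrite lerD2r ler_pM2r ?invr_gt0// -sub0r; exact: h.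
  apply: le_trans (big j i); rewrite affE lerD2r ler_pM2r ?invr_gt0//.
  apply: h; rewrite mul1r [leLHS]addrC -[leRHS]addrA lerD2l /P (negbTE ij) -sumrB; apply: ler_sum => l _.
  have QE : dL1 b alpha (y i 0 l - y j 0 l) = Q i j l by rewrite /Q (negbTE ij).
  rewrite QE; have im : i != ord_max by move: ij; rewrite negb_or => /andP[].
  have := idx_near im l; rewrite -/i.
  move=> /(ler_wpM2l (normr_ge0 (Q i j l))); rewrite -normrM ler_norml => /andP[h1 _].
  move: h1; set X := x 0 l; set q := Q i j l; set A := `|q|; lra.
have h : Saff cc hh qq 1 x <= expR (- (phi i / e) + 2 * lnN).
  apply: le_trans (_ : _ <= \sum_(j < N.+1) expR (- (phi i / e) + lnN)) _.
    apply: ler_sum => j _.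
    rewrite -[leLHS]lnK ?posrE ?invr_gt0 ?(expsum_gt0 ord_max)// ler_expR.
    rewrite lnV ?posrE ?(expsum_gt0 ord_max)//; have := hZ j; lra.
  rewrite sumr_const card_ord -[leLHS]mulr_natl -lnN_exp -expRD.
  by rewrite ler_expR; lra.
have : ln (Saff cc hh qq 1 x) <= - (phi i / e) + 2 * lnN.
  by rewrite -[leRHS]expRK ler_ln// posrE expR_gt0.
have -> : 4 / C * phi i = theta * (phi i / e).
  by rewrite /theta; field; rewrite !gt_eqF.
move: theta0; set X := ln _; nra.
Qed.

Let subsol j k (w : 'I_n -> R) :
  \sum_l (theta * C / 4 * qq j k l * w l - L1 b alpha (w l)) <= theta * C / 4 * hh j k.
Proof.
have /andP[a1 a2] := halpha.
rewrite epsE /hh mulrC divfK ?gt_eqF// /P.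
case: ifPn => kj.
  rewrite -oppr_ge0 -sumrN sumr_ge0// => l _.
  by rewrite /qq /Q kj mul0r mulr0 mul0r sub0r opprK L1_ge0.
apply: ler_sum => l _; rewrite /qq mulrCA divff ?gt_eqF// mulr1.
have := L1_tangent (y k 0 l - y j 0 l) (w l) a1 b0.
by rewrite /Q (negbTE kj); set A := dL1 _ _ _; lra.
Qed.

Let slope : alpha = 1 -> forall j k l, `|theta * C / 4 * qq j k l| <= b.
Proof.
move=> al j k l; rewrite epsE /qq mulrCA divff ?gt_eqF// mulr1 /Q.
case: ifPn => _; first by rewrite normr0 ltW.
by rewrite al; exact: dL1_le1.
Qed.

Lemma dual_bound_smoothed :
  4 / C * (\int[mu]_x (F x * phi (idx x)) + \int[mu]_x psi (idx x)) <=
  r + 8 * e / C * lnN.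
Proof.
have qj0 k l : qq ord_max k l = 0 by rewrite /qq /Q eqxx orbT mul0r.
have hj0 k : hh ord_max k = 0 by rewrite /hh /P eqxx orbT mul0r.
have qk0 j l : qq j ord_max l = 0 by rewrite /qq /Q eqxx mul0r.
have hk0 j : hh j ord_max = 0 by rewrite /hh /P eqxx mul0r.
have main := log_mgf_le_meanU cc halpha ha hC theta0 subsol slope lsi qj0 hj0 qk0 hk0.
have [M UM] := Upot_bounded cc theta0 qj0 hj0 qk0 hk0.
have mU t := measurable_Upot ord_max ord_max cc hh qq theta t.
have G := gibbs mF F0 F1 entF (mU 1) (UM 1).
have mphi := measurable_idx phi; have bphi := idx_bounded phi.
have mpsi := measurable_idx psi; have bpsi := idx_bounded psi.
have iphi := density_mul_integrable mF F0 F1 mphi bphi.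
have ipsi := bounded_integrable mu mpsi bpsi.
have iF := density_integrable mF F0 F1.
have iphi' : mu.-integrable setT (EFin \o (fun x => 4 / C * (F x * phi (idx x)))).
  exact: (integrableZl measurableT (4 / C) iphi).
have iF' : mu.-integrable setT (EFin \o (fun x => 2 * theta * lnN * F x)).
  exact: (integrableZl measurableT (2 * theta * lnN) iF).
have ipsi' : mu.-integrable setT (EFin \o (fun x => - (4 / C) * psi (idx x))).
  exact: (integrableZl measurableT (- (4 / C)) ipsi).
have F1' : \int[mu]_x F x = 1 by rewrite /Rintegral F1.
have A : 4 / C * \int[mu]_x (F x * phi (idx x)) - 2 * theta * lnN <= \int[mu]_x (F x * U 1 x).
  have -> : 2 * theta * lnN = \int[mu]_x (2 * theta * lnN * F x).
    by rewrite RintegralZl// F1' mulr1.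
  rewrite -RintegralZl// -RintegralB//; apply: le_Rintegral => //.
  - exact: (integrableB measurableT iphi' iF').
  - exact: (density_mul_integrable mF F0 F1 (mU 1) (UM 1)).
  - by move=> x _; have := ler_wpM2l (F0 x) (U1_ge x); lra.
have B : \int[mu]_x U 0 x <= - (4 / C) * \int[mu]_x psi (idx x).
  rewrite -RintegralZl//; apply: le_Rintegral => //.
  - exact: bounded_integrable (mU 0) (UM 0).
  - by move=> x _; have := U0_le x; rewrite mulrN mulNr.
have -> : 8 * e / C * lnN = 2 * theta * lnN by rewrite /theta; field; rewrite gt_eqF.
rewrite mulrDr; rewrite -/U in main; lra.
Qed.

End smoothing.

Lemma dual_bound :
  \int[mu]_x (F x * phi (idx x)) + \int[mu]_x psi (idx x) <= C / 4 * r.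
Proof.
rewrite -(ler_pM2l (_ : 0 < 4 / C)) ?divr_gt0//.
have -> : 4 / C * (C / 4 * r) = r by field; rewrite gt_eqF.
apply/ler_addgt0Pr => e e0.
have l0 : 0 <= ln (N.+1%:R : R) by rewrite ln_ge0// ler1n.
(* The temperature [e * C / (8 * L)] makes the loss at most [e]; the added 1 keeps [L] positive when
   [N = 0]. *)
pose L := ln (N.+1%:R : R) + 1; have L0 : 0 < L by rewrite /L; lra.
have e1 : 0 < e * C / (8 * L) by rewrite divr_gt0 ?mulr_gt0.
apply: le_trans (dual_bound_smoothed e1) _; rewrite lerD2l.
have -> : 8 * (e * C / (8 * L)) / C * ln N.+1%:R = e * (ln N.+1%:R / L).
  by field; rewrite !gt_eqF.
by rewrite ler_piMr ?(ltW e0)// ler_pdivrMr// mul1r /L; lra.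
Qed.

End duality.

(** * Transport between discrete measures *)

Section penalised_transport.
Context {R : realType} {m : nat}.
Variables (c : 'I_m -> 'I_m -> R) (nu mu : 'I_m -> R) (lam : R).
Hypotheses (c0 : forall i j, 0 <= c i j) (lam0 : 0 < lam).
Hypotheses (nu0 : forall i, 0 <= nu i) (mu0 : forall i, 0 <= mu i).
Hypotheses (nu1 : \sum_i nu i = 1) (mu1 : \sum_i mu i = 1).

Let row (p : 'I_m -> 'I_m -> R) i := \sum_j p i j.
Let col (p : 'I_m -> 'I_m -> R) j := \sum_i p i j.

Definition penalised_cost (p : 'I_m -> 'I_m -> R) : R :=
  \sum_i \sum_j c i j * p i j +
  (2 * lam)^-1 * (\sum_i (nu i - row p i) ^+ 2 + \sum_j (mu j - col p j) ^+ 2).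

Let bump (p : 'I_m -> 'I_m -> R) i j s : 'I_m -> 'I_m -> R :=
  fun i' j' => p i' j' + s * ((i' == i) && (j' == j))%:R.

Let sum_delta (f : 'I_m -> R) i : \sum_i' f i' * (i' == i)%:R = f i.
Proof.
rewrite (bigD1 i)//= eqxx mulr1 big1 ?addr0// => k ki.
by rewrite (negbTE ki) mulr0.
Qed.

Let row_bump p i j s i' : row (bump p i j s) i' = row p i' + s * (i' == i)%:R.
Proof.
rewrite /row /bump big_split/=; congr (_ + _).
rewrite -(sum_delta (fun=> s * (i' == i)%:R) j); apply: eq_bigr => j' _.
by rewrite -mulrA -natrM mulnb.
Qed.

Let col_bump p i j s j' : col (bump p i j s) j' = col p j' + s * (j' == j)%:R.
Proof.
rewrite /col /bump big_split/=; congr (_ + _).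
rewrite -(sum_delta (fun=> s * (j' == j)%:R) i); apply: eq_bigr => i' _.
by rewrite -mulrA -natrM mulnb andbC.
Qed.

Let sqr_bump (f g : 'I_m -> R) i s :
  \sum_k (f k - (g k + s * (k == i)%:R)) ^+ 2 =
  \sum_k (f k - g k) ^+ 2 - 2 * s * (f i - g i) + s ^+ 2.
Proof.
have -> : 2 * s * (f i - g i) = \sum_k (2 * s * (f k - g k)) * (k == i)%:R by rewrite sum_delta.
rewrite -[X in _ + X](sum_delta (fun=> s ^+ 2) i) -sumrB -big_split/=.
apply: eq_bigr => k _; case: (k == i) => /=; ring.
Qed.

Let cost_bump p i j s : penalised_cost (bump p i j s) = penalised_cost p +
  s * (c i j - (nu i - row p i) / lam - (mu j - col p j) / lam) + s ^+ 2 / lam.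
Proof.
rewrite /penalised_cost.
under [X in _ * (X + _)]eq_bigr do rewrite row_bump.
under [X in _ * (_ + X)]eq_bigr do rewrite col_bump.
rewrite !sqr_bump.
have -> : \sum_i' \sum_j' c i' j' * bump p i j s i' j' =
    \sum_i' \sum_j' c i' j' * p i' j' + s * c i j.
  rewrite -(sum_delta (fun i' => s * c i' j) i) -big_split/=; apply: eq_bigr => i' _.
  rewrite -(sum_delta (fun j' => s * c i' j') j) mulr_suml -big_split/=.
  apply: eq_bigr => j' _; rewrite /bump -mulnb natrM; ring.
by field; rewrite gt_eqF.
Qed.

(** Complementary slackness makes the dual value at the multipliers equal to the cost plus [lam]
    times the sum of their squares. The single bound [V] thus controls both the cost and the
    marginal defects, which are [lam * phi] and [lam * psi]. *)
Lemma penalised_transport (V : R) :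
  (forall phi psi : 'I_m -> R, (forall i j, phi i + psi j <= c i j) ->
    \sum_i phi i * nu i + \sum_j psi j * mu j <= V) ->
  exists p : 'I_m -> 'I_m -> R,
  [/\ forall i j, 0 <= p i j, \sum_i \sum_j c i j * p i j <= V,
      forall i, (nu i - \sum_j p i j) ^+ 2 <= lam * V &
      forall j, (mu j - \sum_i p i j) ^+ 2 <= lam * V].
Proof.
move=> dual.
pose T := [the finType of ('I_m * 'I_m)%type].
pose P (v : 'rV[R]_(#|T|)) i j := v 0 (enum_rank ((i, j) : T)).
(* Comparison with the zero plan bounds every row sum by [1 + sqrt 2 < 3]. The bound 3, there for
   compactness, is thus never attained, and only [p >= 0] can be active. *)
pose box : set 'rV[R]_(#|T|) := [set v | forall k, `[0, 3]%classic (v 0 k)].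
have cbox : compact box by apply: (@rV_compact R _ (fun=> `[0, 3]%classic)) => k; exact: segment_compact.
have box0 : box !=set0 by exists 0 => k /=; rewrite mxE in_itv/= lexx ler0n.
have contP i j : smoothN 0 (fun v => P v i j) by exact: smoothN_coord.
have contSq (f : 'rV[R]_(#|T|) -> R) x : smoothN 0 f -> smoothN 0 (fun v => (x - f v) ^+ 2).
  move=> cf; have cg := smoothND (smoothN_cst 0 x) (smoothNM (smoothN_cst 0 (-1)) cf).
  have := smoothNM cg cg; congr smoothN; apply/funext => v.
  by rewrite !fctE/= mulN1r -expr2.
have cJ : continuous (fun v => penalised_cost (P v)).
  apply: (@smoothN_continuous _ _ 0).
  apply: (@smoothND _ _ 0 (fun v => \sum_i \sum_j c i j * P v i j)).
    apply: smoothN_sum => i; apply: smoothN_sum => j.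
    exact: (smoothNM (smoothN_cst 0 (c i j))).
  apply: (smoothNM (smoothN_cst 0 (2 * lam)^-1)).
  apply: (@smoothND _ _ 0 (fun v => \sum_i (nu i - row (P v) i) ^+ 2)).
    by apply: smoothN_sum => i; apply: contSq; apply: smoothN_sum.
  by apply: smoothN_sum => j; apply: contSq; apply: smoothN_sum.
have [v vbox vmin] := EVT_min_rV box0 cbox (continuous_subspaceT cJ).
rewrite inE in vbox.
pose p := P v.
have p0 i j : 0 <= p i j by have /= := vbox (enum_rank ((i, j) : T)); rewrite in_itv => /andP[].
have p3' i j : p i j <= 3 by have /= := vbox (enum_rank ((i, j) : T)); rewrite in_itv => /andP[].
have pmin q : (forall i j, 0 <= q i j <= 3) -> penalised_cost p <= penalised_cost q.
  move=> q03; pose w : 'rV[R]_(#|T|) := \row_k q (enum_val k).1 (enum_val k).2.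
  have Pw : P w = q.
    by apply/funext => i; apply/funext => j; rewrite /P mxE enum_rankK.
  by rewrite -Pw; apply: vmin; rewrite inE => k /=; rewrite mxE in_itv/=.
have sq_le (f : 'I_m -> R) : (forall i, 0 <= f i) -> \sum_i f i = 1 -> \sum_i f i ^+ 2 <= 1.
  move=> f0 f1; rewrite -[leRHS]f1; apply: ler_sum => i _.
  rewrite expr2 ler_piMl// -f1 (bigD1 i)//= lerDl sumr_ge0//.
have il : 0 < (2 * lam)^-1 by rewrite invr_gt0 mulr_gt0.
have J1 : penalised_cost p <= (2 * lam)^-1 * 2.
  apply: le_trans (pmin (fun _ _ => 0) _) _ => [i j|]; first by rewrite lexx ler0n.
  rewrite /penalised_cost [X in X + _]big1 ?add0r; last first.
    by move=> i _; rewrite big1// => j _; rewrite mulr0.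
  rewrite ler_pM2l// (_ : 2 = 1 + 1)// lerD//.
    by under eq_bigr do rewrite /row big1// subr0; exact: sq_le.
  by under eq_bigr do rewrite /col big1// subr0; exact: sq_le.
have cost0 : 0 <= \sum_i \sum_j c i j * p i j.
  by apply: sumr_ge0 => i _; apply: sumr_ge0 => j _; exact: mulr_ge0.
have row2 i : (nu i - row p i) ^+ 2 <= 2.
  rewrite -(ler_pM2l il); apply: le_trans J1.
  rewrite /penalised_cost -[leLHS]add0r lerD// ler_pM2l//.
  rewrite (bigD1 i)//= -addrA lerDl addr_ge0// sumr_ge0// => k _; exact: sqr_ge0.
have p3 i j : p i j < 3.
  apply: le_lt_trans (_ : row p i < 3).
    by rewrite /row (bigD1 j)//= lerDl sumr_ge0.
  have n1 : nu i <= 1 by rewrite -nu1 (bigD1 i)//= lerDl sumr_ge0.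
  rewrite ltNge; apply/negP => r3; have := row2 i; nra.
(* The dual potentials are the multipliers of the penalised constraints. *)
pose phi i := (nu i - row p i) / lam.
pose psi j := (mu j - col p j) / lam.
(* An entry can always be increased, which yields feasibility of the potentials; it can be decreased
   only where it is positive, which yields complementary slackness. *)
have var i j s : 0 <= p i j + s <= 3 -> 0 <= s * (c i j - phi i - psi j) + s ^+ 2 / lam.
  move=> s03; have : penalised_cost p <= penalised_cost (bump p i j s).
    apply: pmin => i' j'; rewrite /bump; have [->|_] := eqVneq i' i => /=; last first.
      by rewrite mulr0 addr0 p0 p3'.
    have [->|_] := eqVneq j' j; first by rewrite mulr1.
    by rewrite mulr0 addr0 p0 p3'.
  by rewrite cost_bump -addrA lerDl.
have feas i j : phi i + psi j <= c i j.
  set D := c i j - phi i - psi j; suff : 0 <= D by rewrite /D; lra.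
  apply/ler_addgt0Pr => e e0.
  pose s := Num.min (3 - p i j) (e * lam).
  have s0 : 0 < s by rewrite lt_min subr_gt0 p3 mulr_gt0.
  have s1 : s <= 3 - p i j by rewrite ge_min lexx.
  have s2 : s <= e * lam by rewrite ge_min lexx orbT.
  have := var i j s; rewrite -/D; have := p0 i j => p0'.
  have sE : s * D + s ^+ 2 / lam = s * (D + s / lam) by rewrite expr2; ring.
  rewrite sE pmulr_rge0// => H; apply: (le_trans (H _)); first by apply/andP; split; lra.
  by rewrite lerD2l ler_pdivrMr.
have comp i j : p i j * (c i j - phi i - psi j) = 0.
  set D := c i j - phi i - psi j.
  have [->|pn] := eqVneq (p i j) 0; first by rewrite mul0r.
  have pp : 0 < p i j by rewrite lt_neqAle eq_sym pn p0.
  suff : D <= 0.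
    move=> D0; have D0' : 0 <= D by have := feas i j; rewrite /D; lra.
    by rewrite (_ : D = 0) ?mulr0//; apply/eqP; rewrite eq_le D0 D0'.
  apply/ler_addgt0Pr => e e0; rewrite add0r.
  pose s := Num.min (p i j) (e * lam).
  have s0 : 0 < s by rewrite lt_min pp mulr_gt0.
  have s1 : s <= p i j by rewrite ge_min lexx.
  have s2 : s <= e * lam by rewrite ge_min lexx orbT.
  have := var i j (- s); rewrite -/D; have := p3' i j => p3''.
  have sE : - s * D + (- s) ^+ 2 / lam = s * (s / lam - D) by rewrite expr2; ring.
  rewrite sE pmulr_rge0// => H.
  have {}H : 0 <= s / lam - D by apply: H; apply/andP; split; lra.
  have : s / lam <= e by rewrite ler_pdivrMr.
  lra.
have phiE i : nu i - row p i = lam * phi i by rewrite /phi mulrC divfK ?gt_eqF.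
have psiE j : mu j - col p j = lam * psi j by rewrite /psi mulrC divfK ?gt_eqF.
have total : \sum_i \sum_j c i j * p i j + lam * (\sum_i phi i ^+ 2 + \sum_j psi j ^+ 2) <= V.
  apply: le_trans (dual _ _ feas); rewrite le_eqVlt; apply/orP; left; apply/eqP.
  have -> : \sum_i \sum_j c i j * p i j = \sum_i phi i * row p i + \sum_j psi j * col p j.
    rewrite /row /col.
    under [X in _ = X + _]eq_bigr do rewrite mulr_sumr.
    under [X in _ = _ + X]eq_bigr do rewrite mulr_sumr.
    rewrite [X in _ = _ + X]exchange_big -big_split/=; apply: eq_bigr => i _.
    by rewrite -big_split/=; apply: eq_bigr => j _; have := comp i j; lra.
  rewrite mulrDr !mulr_sumr -!big_split/=; apply: eq_bigr => i _.
  have -> : nu i = row p i + lam * phi i by rewrite -phiE addrC subrK.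
  have -> : mu i = col p i + lam * psi i by rewrite -psiE addrC subrK.
  move: (row p i) (col p i) (phi i) (psi i) => r s x y; clear; ring.
have sphi : 0 <= \sum_i phi i ^+ 2 by apply: sumr_ge0 => i _; exact: sqr_ge0.
have spsi : 0 <= \sum_i psi i ^+ 2 by apply: sumr_ge0 => i _; exact: sqr_ge0.
have bound (x S : R) : x ^+ 2 <= S -> \sum_i \sum_j c i j * p i j + lam * S <= V ->
    (lam * x) ^+ 2 <= lam * V.
  move=> xS h; rewrite exprMn expr2 -mulrA ler_pM2l//.
  have : lam * x ^+ 2 <= lam * S by rewrite ler_pM2l.
  lra.
exists p; split => //.
- have : 0 <= lam * (\sum_i phi i ^+ 2 + \sum_j psi j ^+ 2) by rewrite mulr_ge0 ?(ltW lam0) ?addr_ge0.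
  lra.
- move=> i; rewrite -/(row p i) phiE; apply: bound total.
  rewrite (bigD1 i)//= -addrA lerDl addr_ge0// sumr_ge0// => k _; exact: sqr_ge0.
- move=> i; rewrite -/(col p i) psiE; apply: bound total.
  rewrite [X in _ <= _ + X](bigD1 i)//= addrCA lerDl addr_ge0// sumr_ge0// => k _; exact: sqr_ge0.
Qed.

End penalised_transport.

(** One ultrafilter finer than [\oo] makes all entries of the plans converge at once, in place of a
    diagonal extraction. *)
Lemma ultra_bounded_cvg (R : realType) (T : Type) (U : set_system T) (f : T -> R) (a b : R) :
  UltraFilter U -> (forall x, a <= f x <= b) -> exists l : R, f @ U --> l.
Proof.
move=> UU fab; have := @segment_compact R a b.
move=> /(_ (f @ U) _) [].
  by apply: (@filterE _ U) => x; rewrite /= in_itv/= fab.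
move=> l [_ cl]; exists l => V Vl.
have [//|nV] := in_ultra_setVsetC (f @^-1` V) UU.
by have [y [/= ny Vy]] := cl (~` V) V nV Vl.
Qed.

Lemma cvg_sum_ord (R : realType) (T : Type) (U : set_system T) {FU : Filter U}
    (K : nat) (f : T -> nat -> R) (l : nat -> R) :
  (forall i, f x i @[x --> U] --> l i) ->
  \sum_(i < K) f x i @[x --> U] --> \sum_(i < K) l i.
Proof.
move=> fl; elim: K => [|K ih].
  by rewrite big_ord0; under eq_fun do rewrite big_ord0; exact: cvg_cst.
by rewrite big_ord_recr/=; under eq_fun do rewrite big_ord_recr/=; exact: cvgD.
Qed.

Lemma ler_sum_widen (R : realType) (K N : nat) (f : nat -> R) :
  (forall i, 0 <= f i) -> (K <= N)%N -> \sum_(i < K) f i <= \sum_(i < N) f i.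
Proof.
move=> f0 KN; rewrite -(subnKC KN) big_split_ord/= lerDl sumr_ge0//.
Qed.

Section truncated_transport.
Context {R : realType}.
Variables (c : nat -> nat -> R) (nu mu : nat -> R) (V : R).
Hypotheses (c0 : forall i j, 0 <= c i j) (V0 : 0 <= V).
Hypotheses (nu0 : forall i, 0 <= nu i) (mu0 : forall i, 0 <= mu i).
Hypotheses (nu1 : forall n, \sum_(i < n) nu i <= 1) (mu1 : forall n, \sum_(i < n) mu i <= 1).

Definition tail (f : nat -> R) (n : nat) : R := 1 - \sum_(i < n) f i.

Definition lump (f : nat -> R) N (i : 'I_N.+1) : R := if i == ord_max then tail f N else f i.

Definition lump_cost N (i j : 'I_N.+1) : R :=
  if (i == ord_max) || (j == ord_max) then 0 else c i j.

Hypothesis dual : forall N (phi psi : 'I_N.+1 -> R),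
  (forall i j, phi i + psi j <= lump_cost i j) ->
  \sum_i phi i * lump nu i + \sum_j psi j * lump mu j <= V.

(** With [lam = (N+1)^-4] each marginal defect is at most [sqrt (lam V) <= err N]; the squared
    denominator makes even a sum of [N+1] defects tend to 0. *)
Let err N : R := (V + 1) / N.+1%:R ^+ 2.

Let lump_widen N f (i : 'I_N) : lump f (widen_ord (leqnSn N) i) = f i.
Proof. by rewrite /lump -val_eqE/= ltn_eqF. Qed.

Let lump_max N f : lump f (ord_max : 'I_N.+1) = tail f N.
Proof. by rewrite /lump eqxx. Qed.

Let lump_sum N (f : nat -> R) : \sum_(i < N.+1) lump f i = 1.
Proof.
rewrite big_ord_recr/= lump_max /tail.
by under eq_bigr do rewrite lump_widen; rewrite addrC subrK.
Qed.

(** Dropping the remainder column takes from a row a single entry, bounded by the whole column,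
    hence by [tail mu N + err N]; the second [err N] is the defect of the row itself. Columns are
    treated symmetrically. *)
Lemma finite_stage N : exists p : nat -> nat -> R,
  [/\ forall i j, 0 <= p i j,
      \sum_(i < N) \sum_(j < N) c i j * p i j <= V,
      forall i, (i < N)%N -> nu i - tail mu N - 2 * err N <= \sum_(j < N) p i j <= nu i + err N &
      forall j, (j < N)%N -> mu j - tail nu N - 2 * err N <= \sum_(i < N) p i j <= mu j + err N].
Proof.
have N0 : 0 < N.+1%:R ^+ 2 :> R by rewrite exprn_gt0 ?ltr0n.
pose lam : R := (N.+1%:R ^+ 2) ^- 2.
have lam0 : 0 < lam by rewrite invr_gt0 exprn_gt0.
have cN0 (i j : 'I_N.+1) : 0 <= lump_cost i j by rewrite /lump_cost; case: ifP.
have l0 (f : nat -> R) : (forall i, 0 <= f i) -> (forall n, \sum_(i < n) f i <= 1) ->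
    forall i : 'I_N.+1, 0 <= lump f i.
  by move=> f0 f1 i; rewrite /lump; case: ifP => // _; rewrite subr_ge0.
have [p [p0 pV prow pcol]] := penalised_transport cN0 lam0 (l0 _ nu0 nu1) (l0 _ mu0 mu1)
  (lump_sum _ _) (lump_sum _ _) (@dual N).
have e0 : 0 < err N by rewrite divr_gt0// ltr_wpDl.
have sq x : x ^+ 2 <= lam * V -> - err N <= x <= err N.
  move=> h; rewrite -ler_norml -(ler_pXn2r (_ : 0 < 2)%N) ?nnegrE ?(ltW e0)//.
  rewrite -normrX ger0_norm ?sqr_ge0//; apply: (le_trans h).
  rewrite /err expr_div_n mulrC ler_pM2r//; nra.
pose w := widen_ord (leqnSn N).
pose q (i j : nat) : R := if (i < N)%N && (j < N)%N then p (inord i) (inord j) else 0.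
have qE (i j : 'I_N) : q i j = p (w i) (w j).
  rewrite /q !ltn_ord/=; congr p; apply/val_inj; rewrite /= inordK// ltnS ltnW//.
have rowE i : \sum_(j < N.+1) p (w i) j = \sum_(j < N) q i j + p (w i) ord_max.
  by rewrite big_ord_recr/=; congr (_ + _); apply: eq_bigr => j _; rewrite qE.
have colE j : \sum_(i < N.+1) p i (w j) = \sum_(i < N) q i j + p ord_max (w j).
  by rewrite big_ord_recr/=; congr (_ + _); apply: eq_bigr => i _; rewrite qE.
exists q; split.
- by move=> i j; rewrite /q; case: ifP.
- apply: le_trans pV; rewrite [leRHS]big_ord_recr/= -[leLHS]addr0 lerD//; last first.
    by apply: sumr_ge0 => j _; rewrite mulr_ge0.
  apply: ler_sum => i _; rewrite [leRHS]big_ord_recr/= -[leLHS]addr0 lerD//; last first.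
    by rewrite mulr_ge0.
  by apply: ler_sum => j _; rewrite -qE /lump_cost -!val_eqE/= !ltn_eqF.
- move=> i iN; have /andP[] := sq _ (prow (w (Ordinal iN))).
  rewrite rowE lump_widen/=; set r := \sum_(j < N) _.
  have := p0 (w (Ordinal iN)) ord_max.
  have : p (w (Ordinal iN)) ord_max <= \sum_i p i ord_max.
    by rewrite (bigD1 (w (Ordinal iN)))//= lerDl sumr_ge0.
  have /andP[] := sq _ (pcol ord_max); rewrite lump_max.
  set s := \sum_i _; set x := p _ _ => *; apply/andP; split; lra.
- move=> i iN; have /andP[] := sq _ (pcol (w (Ordinal iN))).
  rewrite colE lump_widen/=; set r := \sum_(j < N) _.
  have := p0 ord_max (w (Ordinal iN)).
  have : p ord_max (w (Ordinal iN)) <= \sum_i p ord_max i.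
    by rewrite (bigD1 (w (Ordinal iN)))//= lerDl sumr_ge0.
  have /andP[] := sq _ (prow ord_max); rewrite lump_max.
  set s := \sum_i _; set x := p _ _ => *; apply/andP; split; lra.
Qed.

Let err_le N : N.+1%:R * err N <= (V + 1) / N.+1%:R.
Proof.
have N0 : 0 < N.+1%:R :> R by rewrite ltr0n.
by rewrite /err le_eqVlt; apply/orP; left; apply/eqP; field; rewrite gt_eqF.
Qed.

(** Tightness: the entries between [K] and [N] are bounded by the other marginal [f], up to errors,
    so the mass of a row cannot escape to infinity with [N]. *)
Let partial_row (f : nat -> R) (q : nat -> R) K N x : (K <= N)%N ->
  (forall j, (j < N)%N -> q j <= f j + err N) ->
  x <= \sum_(j < N) q j ->
  x - (tail f K - tail f N) - N.+1%:R * err N <= \sum_(j < K) q j.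
Proof.
move=> KN qf; have e0 : 0 <= err N by rewrite divr_ge0 ?sqr_ge0// addr_ge0.
have /subnKC NE := KN.
have -> : tail f K - tail f N = \sum_(j < N - K) f (K + j)%N.
  rewrite /tail -[in \sum_(i < N) _]NE big_split_ord/=; ring.
have -> : \sum_(j < N) q j = \sum_(j < K) q j + \sum_(j < N - K) q (K + j)%N.
  by rewrite -[in LHS]NE big_split_ord.
have : \sum_(j < N - K) q (K + j)%N <= \sum_(j < N - K) (f (K + j)%N + err N).
  by apply: ler_sum => j _; apply: qf; rewrite -ltn_subRL.
rewrite big_split/= sumr_const card_ord -mulr_natl.
have : (N - K)%:R * err N <= N.+1%:R * err N.
  by rewrite ler_wpM2r// ler_nat (leq_trans (leq_subr _ _)).
lra.
Qed.

(** Finite partial sums pass to the limit. In the lower bounds the tail at [N] lost in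
    [finite_stage] cancels the one gained in [partial_row]; only a tail at [K] remains, and letting
    [K] grow makes the marginals exact. *)
Lemma infinite_transport : exists p : nat -> nat -> R,
  [/\ forall i j, 0 <= p i j,
      forall K, \sum_(i < K) \sum_(j < K) c i j * p i j <= V,
      forall i K, nu i - tail mu K <= \sum_(j < K) p i j <= nu i &
      forall j K, mu j - tail nu K <= \sum_(i < K) p i j <= mu j].
Proof.
have /choice[p hp] := finite_stage.
have [U [UU sU]] := @ultraFilterLemma nat \oo _.
have e0 N : 0 <= err N by rewrite divr_ge0 ?sqr_ge0// addr_ge0.
have el N : err N <= V + 1.
  rewrite ler_pdivrMr ?exprn_gt0 ?ltr0n// ler_peMr ?addr_ge0//.
  by rewrite expr_ge1 ?ler1n ?ler0n.
have t0 (f : nat -> R) n : (forall n, \sum_(i < n) f i <= 1) -> 0 <= tail f n.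
  by move=> f1; rewrite subr_ge0.
have pb N i j : (i < N)%N -> (j < N)%N -> 0 <= p N i j <= V + 2.
  move=> iN jN; have [p0 _ pr _] := hp N; rewrite p0/=.
  have /andP[_ h] := pr i iN.
  have : p N i j <= \sum_(j < N) p N i j.
    by rewrite (bigD1 (Ordinal jN))//= lerDl sumr_ge0.
  have := el N; have := nu1 i.+1; rewrite big_ord_recr/=.
  have : 0 <= \sum_(k < i) nu k by rewrite sumr_ge0.
  lra.
(* The bound [pb] holds only inside the square of size [N]; truncation makes each entry bounded
   uniformly in [N]. *)
pose p' N i j := if (i < N)%N && (j < N)%N then p N i j else 0.
have /choice[L hL] : forall ij : nat * nat, exists l : R, p' N ij.1 ij.2 @[N --> U] --> l.
  move=> [i j]; apply: (@ultra_bounded_cvg _ _ _ _ 0 (V + 2)) => N /=.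
  rewrite /p'; case: ifPn => [/andP[iN jN]|_]; first exact: pb.
  by rewrite lexx addr_ge0.
pose l i j := L (i, j).
have lE i j : p' N i j @[N --> U] --> l i j by exact: (hL (i, j)).
have evU (P : nat -> Prop) : (\forall N \near \oo, P N) -> \forall N \near U, P N.
  by move=> h; exact: sU h.
have small d : 0 < d -> \forall N \near U, N.+1%:R * err N <= d /\ err N <= d.
  move=> d0; apply: evU.
  have : (fun N => (V + 1) * N.+1%:R^-1 : R) @ \oo --> ((V + 1) * 0 : R).
    by apply: cvgM; [exact: cvg_cst|exact: cvg_harmonic].
  rewrite mulr0 => /cvgr_le /(_ d d0); apply: filterS => N h.
  have A : N.+1%:R * err N <= d by exact: le_trans (err_le N) h.
  by split => //; apply: le_trans A; rewrite ler_peMl ?e0 ?ler1n.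
have big K : \forall N \near U, (K < N)%N.
  by apply: evU; exact: nbhs_infty_gt.
exists l; split.
- move=> i j; apply: (cvgr_to_ge (lE i j)); near=> N.
  by rewrite /p'; case: ifP => // _; have [p0 _ _ _] := hp N.
- move=> K.
  have cl : \sum_(i < K) \sum_(j < K) c i j * p' N i j @[N --> U] -->
      \sum_(i < K) \sum_(j < K) c i j * l i j.
    apply: (@cvg_sum_ord _ _ _ _ K (fun N i => \sum_(j < K) c i j * p' N i j)
      (fun i => \sum_(j < K) c i j * l i j)) => i.
    apply: (@cvg_sum_ord _ _ _ _ K (fun N j => c i j * p' N i j) (fun j => c i j * l i j)) => j.
    by apply: cvgM; [exact: cvg_cst|exact: lE].
  apply: (cvgr_to_le cl); near=> N.
  have KN : (K < N)%N by near: N; exact: big.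
  have [p0 pV _ _] := hp N; apply: le_trans pV.
  apply: le_trans (_ : _ <= \sum_(i < K) \sum_(j < N) c i j * p N i j) _; last first.
    apply: (@ler_sum_widen _ K N (fun i => \sum_(j < N) c i j * p N i j)); last exact: ltnW.
    by move=> i; apply: sumr_ge0 => j _; exact: mulr_ge0.
  apply: ler_sum => i _.
  apply: le_trans (_ : _ <= \sum_(j < K) c i j * p N i j) _; last first.
    apply: (@ler_sum_widen _ K N (fun j => c i j * p N i j)); last exact: ltnW.
    by move=> j; exact: mulr_ge0.
  by apply: ler_sum => j _; rewrite /p' !(ltn_trans _ KN)//=.
- move=> i K.
  have cl : \sum_(j < K) p' N i j @[N --> U] --> \sum_(j < K) l i j.
    exact: (@cvg_sum_ord _ _ _ _ K (fun N j => p' N i j) (l i)).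
  apply/andP; split.
    apply/ler_addgt0Pr => d d0; rewrite -lerBlDr.
    apply: (cvgr_to_ge cl); near=> N.
    have KN : (K < N)%N by near: N; exact: big.
    have iN : (i < N)%N by near: N; exact: big.
    have [A B] : N.+1%:R * err N <= d / 3 /\ err N <= d / 3.
      by near: N; apply: small; rewrite divr_gt0.
    have [p0 _ pr pc] := hp N; have /andP[h _] := pr i iN.
    have -> : \sum_(j < K) p' N i j = \sum_(j < K) p N i j.
      by apply: eq_bigr => j _; rewrite /p' iN (ltn_trans _ KN).
    have qmu j : (j < N)%N -> p N i j <= mu j + err N.
      move=> jN; have /andP[_] := pc j jN; apply: le_trans.
      by rewrite (bigD1 (Ordinal iN))//= lerDl sumr_ge0.
    have := partial_row (ltnW KN) qmu h; have := t0 _ N mu1; lra.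
  apply/ler_addgt0Pr => d d0; apply: (cvgr_to_le cl); near=> N.
  have KN : (K < N)%N by near: N; exact: big.
  have iN : (i < N)%N by near: N; exact: big.
  have [A B] : N.+1%:R * err N <= d / 3 /\ err N <= d / 3.
    by near: N; apply: small; rewrite divr_gt0.
  have [p0 _ pr pc] := hp N; have /andP[_ h] := pr i iN.
  have -> : \sum_(j < K) p' N i j = \sum_(j < K) p N i j.
    by apply: eq_bigr => j _; rewrite /p' iN (ltn_trans _ KN).
  have := ler_sum_widen (p0 i) (ltnW KN); lra.
- move=> i K.
  have cl : \sum_(j < K) p' N j i @[N --> U] --> \sum_(j < K) l j i.
    exact: (@cvg_sum_ord _ _ _ _ K (fun N j => p' N j i) (l ^~ i)).
  apply/andP; split.
    apply/ler_addgt0Pr => d d0; rewrite -lerBlDr.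
    apply: (cvgr_to_ge cl); near=> N.
    have KN : (K < N)%N by near: N; exact: big.
    have iN : (i < N)%N by near: N; exact: big.
    have [A B] : N.+1%:R * err N <= d / 3 /\ err N <= d / 3.
      by near: N; apply: small; rewrite divr_gt0.
    have [p0 _ pr pc] := hp N; have /andP[h _] := pc i iN.
    have -> : \sum_(j < K) p' N j i = \sum_(j < K) p N j i.
      by apply: eq_bigr => j _; rewrite /p' iN andbT (ltn_trans _ KN).
    have qnu j : (j < N)%N -> p N j i <= nu j + err N.
      move=> jN; have /andP[_] := pr j jN; apply: le_trans.
      by rewrite (bigD1 (Ordinal iN))//= lerDl sumr_ge0.
    have := partial_row (q := p N ^~ i) (ltnW KN) qnu h; have := t0 _ N nu1; lra.
  apply/ler_addgt0Pr => d d0; apply: (cvgr_to_le cl); near=> N.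
  have KN : (K < N)%N by near: N; exact: big.
  have iN : (i < N)%N by near: N; exact: big.
  have [A B] : N.+1%:R * err N <= d / 3 /\ err N <= d / 3.
    by near: N; apply: small; rewrite divr_gt0.
  have [p0 _ pr pc] := hp N; have /andP[_ h] := pc i iN.
  have -> : \sum_(j < K) p' N j i = \sum_(j < K) p N j i.
    by apply: eq_bigr => j _; rewrite /p' iN andbT (ltn_trans _ KN).
  have := ler_sum_widen (p0 ^~ i) (ltnW KN); lra.
Unshelve. all: by end_near. Qed.

End truncated_transport.

(** * Couplings from discrete transport plans *)

Section density_measure.
Context {d} {T : measurableType d} {R : realType}.
Variables (mu : {measure set T -> \bar R}) (F : T -> R).
Hypotheses (mF : measurable_fun setT F) (F0 : forall x, 0 <= F x).
Hypothesis F1 : (\int[mu]_x (F x)%:E = 1)%E.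

(** The hypotheses are arguments so that the measure and probability structures can be attached to
    the constant and inferred wherever it is applied. *)
Definition mdensity of measurable_fun setT F & (forall x, 0 <= F x) &
  (\int[mu]_x (F x)%:E = 1)%E := fun A => (\int[mu]_(x in A) (F x)%:E)%E.

Local Notation nu := (mdensity mF F0 F1).

Let nu0 : nu set0 = 0%E. Proof. by rewrite /mdensity integral_set0. Qed.

Let nu_ge0 A : (0 <= nu A)%E.
Proof. by apply: integral_ge0 => x _; rewrite lee_fin. Qed.

Let nu_sigma : semi_sigma_additive nu.
Proof.
by apply: semi_sigma_additive_nng_induced => //; exact/measurable_EFinP.
Qed.

HB.instance Definition _ := isMeasure.Build _ _ _ nu nu0 nu_ge0 nu_sigma.

Let nu1 : nu setT = 1%E. Proof. exact: F1. Qed.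

HB.instance Definition _ := Measure_isProbability.Build _ _ _ nu nu1.

End density_measure.

Section conditional.
Context {d} {T : measurableType d} {R : realType}.
Variables (nu : probability T R) (A : set T) (mA : measurable A).

(** On a null set the normalisation falls back on [nu], so this is always a probability; the product
    form of [conditionalE] covers that case too. *)
Definition conditional : probability T R := mnormalize (mrestr nu mA) nu.

Lemma conditionalE B : measurable B -> (nu A * conditional B = nu (B `&` A))%E.
Proof.
move=> mB; have rA : mrestr nu mA setT = nu A by rewrite /mrestr setTI.
rewrite /conditional/= /mnormalize/= rA /mrestr.
have nA : nu A \is a fin_num by exact: fin_num_measure.
have mBA : measurable (B `&` A) by exact: measurableI.
case: ifPn => [/orP[/eqP A0|/eqP Ay]|/norP[A0 _]].
- by rewrite A0 mul0e; apply/esym/(subset_measure0 (B := A)).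
- by move: nA; rewrite Ay.
- by rewrite muleC -muleA -[X in (_ * (_ * X))%E](fineK nA) -EFinM mulVf ?mule1// fine_eq0.
Qed.

Lemma conditional_self : (nu A != 0)%E -> conditional A = 1%E.
Proof.
move=> nA0; have := conditionalE mA; rewrite setIid.
have nA : nu A \is a fin_num by exact: fin_num_measure.
have cA : conditional A \is a fin_num by exact: fin_num_measure.
rewrite -(fineK nA) -(fineK cA) -EFinM => -[] /eqP.
rewrite -subr_eq0 -{2}[fine (nu A)]mulr1 -mulrBr mulf_eq0 fine_eq0// (negbTE nA0)/=.
by rewrite subr_eq0 => /eqP ->.
Qed.

End conditional.

Lemma nneseries_squeeze (R : realType) (q : nat -> R) (t : nat -> R) (x : R) :
  t @ \oo --> 0 -> (forall K, x - t K <= \sum_(i < K) q i <= x) ->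
  (\sum_(i <oo) (q i)%:E = x%:E)%E.
Proof.
move=> t0 tx; apply/cvg_lim => //.
have -> : (fun n => \sum_(0 <= i < n) (q i)%:E)%E = (fun n => (\sum_(i < n) q i)%:E).
  by apply/funext => n; rewrite big_mkord sumEFin.
apply: cvg_EFin; first exact: nearW.
apply: (@squeeze_cvgr _ _ _ _ (fun K => x - t K) (fun=> x)).
- by apply: nearW => K; exact: tx.
- by rewrite -[X in _ --> X]subr0; apply: cvgB => //; exact: cvg_cst.
- exact: cvg_cst.
Qed.

Lemma nneseries2_le (R : realType) (a : nat -> nat -> R) (V : R) :
  (forall i j, 0 <= a i j) ->
  (forall K, \sum_(i < K) \sum_(j < K) a i j <= V) ->
  (\sum_(i <oo) \sum_(j <oo) (a i j)%:E <= V%:E)%E.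
Proof.
move=> a0 aV; apply: lime_le.
  by apply: is_cvg_nneseries => i _ _; apply: nneseries_ge0 => j _ _; rewrite lee_fin.
apply: nearW => I.
rewrite big_mkord -nneseries_sum; last by move=> i j _; rewrite lee_fin.
apply: lime_le.
  by apply: is_cvg_nneseries => i _ _; apply: sume_ge0 => j _; rewrite lee_fin.
apply: nearW => J; rewrite big_mkord.
under eq_bigr do rewrite sumEFin; rewrite sumEFin lee_fin.
rewrite exchange_big/=; apply: le_trans (aV (maxn I J)).
apply: le_trans (_ : _ <= \sum_(i < I) \sum_(j < maxn I J) a i j) _.
  by apply: ler_sum => i _; apply: (ler_sum_widen (f := a i)) => //; exact: leq_maxr.
apply: (ler_sum_widen (f := fun i => \sum_(j < maxn I J) a i j)); last exact: leq_maxl.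
by move=> i; exact: sumr_ge0.
Qed.

Section gluing.
Context {d} {T : measurableType d} {R : realType}.
Variables (nu mu : probability T R) (A : nat -> set T) (p : nat -> nat -> R).
Hypotheses (mA : forall i, measurable (A i)) (tA : trivIset setT A).
Hypothesis cA : \bigcup_i A i = setT.
Hypothesis p0 : forall i j, 0 <= p i j.
Hypothesis rows : forall i, (\sum_(j <oo) (p i j)%:E = nu (A i))%E.
Hypothesis cols : forall j, (\sum_(i <oo) (p i j)%:E = mu (A j))%E.

Let P i := conditional nu (mA i).
Let Q j := conditional mu (mA j).

Definition glued_row i : {measure set (T * T) -> \bar R} :=
  mseries (fun j => mscale (NngNum (p0 i j)) (P i \x Q j)%E) 0.
Definition glued : set (T * T) -> \bar R := mseries glued_row 0.

HB.instance Definition _ := Measure.on glued.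

Let gluedE B : (glued B = \sum_(i <oo) \sum_(j <oo) ((p i j)%:E * (P i \x Q j) B))%E.
Proof. by []. Qed.

Let split_mass (m : probability T R) B : measurable B ->
  (\sum_(i <oo) m (A i) * conditional m (mA i) B = m B)%E.
Proof.
move=> mB; rewrite -[B in RHS]setIT -cA setI_bigcupr measure_semi_bigcup.
- by apply: eq_eseriesr => i _; rewrite conditionalE.
- by move=> i; exact: measurableI.
- exact: trivIset_setIl.
- by apply: bigcupT_measurable => i; exact: measurableI.
Qed.

Let prodT (P1 P2 : probability T R) B : measurable B ->
  ((P1 \x P2) (B `*` setT) = P1 B)%E /\ ((P1 \x P2) (setT `*` B) = P2 B)%E.
Proof.
move=> mB; rewrite !product_measure1E//=.
by rewrite !probability_setT mule1 mul1e.
Qed.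

Lemma glued_fst B : measurable B -> glued (B `*` setT) = nu B.
Proof.
move=> mB; rewrite gluedE -(split_mass nu mB); apply: eq_eseriesr => i _.
have PB : P i B \is a fin_num by exact: fin_num_measure.
rewrite -rows muleC -(fineK PB) -nneseriesZl; last by move=> j _; rewrite lee_fin.
apply: eq_eseriesr => j _; rewrite fineK// muleC; congr (_ * _)%E.
exact: (prodT (P i) (Q j) mB).1.
Qed.

Lemma glued_snd B : measurable B -> glued (setT `*` B) = mu B.
Proof.
move=> mB; rewrite gluedE -(split_mass mu mB) nneseries_interchange; last first.
  by move=> i j; rewrite mule_ge0 ?lee_fin.
apply: eq_eseriesr => j _.
have QB : Q j B \is a fin_num by exact: fin_num_measure.
rewrite -cols muleC -(fineK QB) -nneseriesZl; last by move=> i _; rewrite lee_fin.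
apply: eq_eseriesr => i _; rewrite fineK// muleC; congr (_ * _)%E.
exact: (prodT (P i) (Q j) mB).2.
Qed.

Let glued1 : glued setT = 1%E.
Proof. by rewrite -setXTT glued_fst// probability_setT. Qed.

HB.instance Definition _ := Measure_isProbability.Build _ _ _ glued glued1.

Let entry_le i j : ((p i j)%:E <= nu (A i))%E /\ ((p i j)%:E <= mu (A j))%E.
Proof.
split.
  rewrite -rows; apply: le_trans (nneseries_lim_ge j.+1 _) => [|k _ _]; last by rewrite lee_fin.
  by rewrite big_nat_recr//= leeDr// sume_ge0// => k _; rewrite lee_fin.
rewrite -cols; apply: le_trans (nneseries_lim_ge i.+1 _) => [|k _ _]; last by rewrite lee_fin.
by rewrite big_nat_recr//= leeDr// sume_ge0// => k _; rewrite lee_fin.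
Qed.

(** The bound on [g] is known only on the product of the cells [A i] and [A j]. That product has
    full measure for [P i \x Q j] as soon as [p i j > 0], for then both cells have positive mass by
    [entry_le]; if [p i j = 0] the term vanishes. *)
Lemma glued_cost_le (g : T * T -> \bar R) (e : nat -> nat -> R) (V : R) :
  measurable_fun setT g -> (forall z, 0 <= g z)%E -> (forall i j, 0 <= e i j) ->
  (forall i j x y, A i x -> A j y -> (g (x, y) <= (e i j)%:E)%E) ->
  (forall K, \sum_(i < K) \sum_(j < K) e i j * p i j <= V) ->
  (\int[glued]_z g z <= V%:E)%E.
Proof.
move=> mg g0 e0 ge eV.
rewrite ge0_integral_measure_series//.
apply: le_trans (nneseries2_le (a := fun i j => e i j * p i j) _ eV); last first.
  by move=> i j; exact: mulr_ge0.
apply: lee_nneseries => [i _ _|i _]; first exact: integral_ge0.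
rewrite ge0_integral_measure_series//.
apply: lee_nneseries => [j _ _|j _]; first exact: integral_ge0.
rewrite ge0_integral_mscale//= EFinM muleC.
have [->|pij] := eqVneq (p i j) 0; first by rewrite !mule0.
rewrite lee_wpmul2r ?lee_fin//.
have [h1 h2] := entry_le i j.
have pp : (0 < (p i j)%:E)%E by rewrite lte_fin lt_neqAle eq_sym pij p0.
have PA : P i (A i) = 1%E by apply: conditional_self; rewrite gt_eqF// (lt_le_trans pp).
have QA : Q j (A j) = 1%E by apply: conditional_self; rewrite gt_eqF// (lt_le_trans pp).
have mAA : measurable (A i `*` A j) by exact: measurableX.
apply: (@le_trans _ _ (\int[P i \x Q j]_z cst (e i j)%:E z)%E); last first.
  by rewrite integral_cst//= -setXTT (prodT _ _ measurableT).1 probability_setT mule1.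
apply: ae_ge0_le_integral => //; first by move=> z _; rewrite lee_fin.
exists (~` (A i `*` A j)); split.
- exact: measurableC.
- have PQ : (P i \x Q j)%E (A i `*` A j) = 1%E.
    by rewrite product_measure1E//; rewrite [X in (X * _)%E]PA [X in (_ * X)%E]QA mule1.
  by rewrite [LHS](probability_setC (P i \x Q j)%E)//; rewrite [X in (_ - X)%E]PQ subee.
- move=> [x y] /= ngz [Ax Ay]; apply: ngz => _; exact: ge.
Qed.

Lemma gluing : exists pi : probability (T * T)%type R,
  [/\ forall B, measurable B -> pi (B `*` setT) = nu B,
      forall B, measurable B -> pi (setT `*` B) = mu B &
      forall (g : T * T -> \bar R) (e : nat -> nat -> R) (V : R),
        measurable_fun setT g -> (forall z, 0 <= g z)%E ->
        (forall i j, 0 <= e i j) ->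
        (forall i j x y, A i x -> A j y -> (g (x, y) <= (e i j)%:E)%E) ->
        (forall K, \sum_(i < K) \sum_(j < K) e i j * p i j <= V) ->
        (\int[pi]_z g z <= V%:E)%E].
Proof.
exists (glued : probability (T * T)%type R); split.
- exact: glued_fst.
- exact: glued_snd.
- exact: glued_cost_le.
Qed.

End gluing.

(** * Grid cells and their masses *)

Section grid.
Context {R : realType} {n : nat}.
Variable delta : R.
Hypothesis delta0 : 0 < delta.

(** [pickle] numbers the countably many cells by naturals. A natural that codes no cell has empty
    preimage, and the default 0 in [grid_point] is taken only there. *)
Definition grid_index (x : borelRn R n) : nat :=
  pickle [ffun l : 'I_n => Num.floor (x 0 l / delta)].

Definition grid_point (m : nat) : 'rV[R]_n :=
  if unpickle m is Some k then \row_l (((k : {ffun 'I_n -> int}) l)%:~R * delta) else 0.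

Lemma grid_near (x : 'rV[R]_n) l : `|x 0 l - grid_point (grid_index x) 0 l| <= delta.
Proof.
rewrite /grid_point /grid_index pickleK mxE ffunE.
have /andP[h1 h2] := floor_itv (x 0 l / delta).
move: h1 h2; rewrite ler_pdivlMr// ltr_pdivrMr// intrD mulrDl mul1r => h1 h2.
by rewrite ger0_norm; lra.
Qed.

Lemma measurable_coord (l : 'I_n) :
  measurable_fun setT (fun x : borelRn R n => (x : 'rV[R]_n) 0 l).
Proof. apply: continuous_measurable_borelRn; exact: coord_continuous. Qed.

Lemma measurable_grid_cell m : measurable (grid_index @^-1` [set m]).
Proof.
case km : (unpickle m : option {ffun 'I_n -> int}) => [k|]; last first.
  rewrite (_ : _ @^-1` _ = set0) ?measurable0//; apply/seteqP; split => // x /= xm.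
  by move: km; rewrite -xm /grid_index pickleK.
have [mk|mk] := eqVneq (pickle k) m; last first.
  rewrite (_ : _ @^-1` _ = set0) ?measurable0//; apply/seteqP; split => // x /= xm.
  by move: km mk; rewrite -xm /grid_index pickleK => -[->]; rewrite eqxx.
have itvE (x : borelRn R n) l : ((k l)%:~R * delta <= (x : 'rV[R]_n) 0 l < (k l + 1)%:~R * delta) =
    (Num.floor ((x : 'rV[R]_n) 0 l / delta) == k l).
  rewrite -ler_pdivlMr// -ltr_pdivrMr//; apply/idP/eqP => [h|<-].
    exact: floor_def.
  exact: floor_itv.
rewrite (_ : _ @^-1` _ = \bigcap_(l in [set: 'I_n])
    ((fun x : borelRn R n => (x : 'rV[R]_n) 0 l) @^-1` `[(k l)%:~R * delta, (k l + 1)%:~R * delta[)).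
  apply: fin_bigcap_measurable => // l _; rewrite -[X in measurable X]setTI.
  exact: measurable_coord.
apply/seteqP; split => x /=.
  move=> xm l _ /=; rewrite in_itv/= itvE.
  by move: km; rewrite -xm /grid_index pickleK => -[<-]; rewrite ffunE.
move=> xk; rewrite -mk; congr pickle; apply/ffunP => l; rewrite ffunE.
by have /= := xk l Logic.I; rewrite in_itv/= itvE => /eqP.
Qed.

End grid.

Section cell_masses.
Context {d} {T : measurableType d} {R : realType}.
Variables (mu : probability T R) (G : T -> R) (idx : T -> nat).
Hypotheses (mG : measurable_fun setT G) (G0 : forall x, 0 <= G x).
Hypothesis G1 : (\int[mu]_x (G x)%:E = 1)%E.
Hypothesis midx : forall m, measurable (idx @^-1` [set m]).

Definition cell_mass (m : nat) : R := fine (\int[mu]_(x in idx @^-1` [set m]) (G x)%:E).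

Definition lump_index N x : 'I_N.+1 := if (idx x < N)%N then inord (idx x) else ord_max.

Lemma lump_index_lt N x : lump_index N x != ord_max -> (lump_index N x : nat) = idx x.
Proof.
rewrite /lump_index; case: ifPn => [xN _|]; last by rewrite eqxx.
by rewrite inordK// ltnS ltnW.
Qed.

Lemma lump_index_preimage N (i : 'I_N.+1) : (i < N)%N ->
  lump_index N @^-1` [set i] = idx @^-1` [set i : nat].
Proof.
move=> iN; apply/seteqP; split => x /=.
  by move=> xi; rewrite -(@lump_index_lt N x) ?xi// -val_eqE/= ltn_eqF.
by move=> xi; rewrite /lump_index xi iN; apply/val_inj; rewrite /= inordK// ltnS ltnW.
Qed.

Lemma measurable_lump_index N (i : 'I_N.+1) : measurable (lump_index N @^-1` [set i]).
Proof.
have [iN|] := ltnP i N; first by rewrite lump_index_preimage.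
move=> Ni; have -> : lump_index N @^-1` [set i] =
    ~` (\big[setU/set0]_(j < N) (idx @^-1` [set (j : nat)])).
  rewrite -(bigcup_mkord N (fun j => idx @^-1` [set j])); apply/seteqP; split => x /=.
    move=> xi [j /= jN xj]; move: xi; rewrite /lump_index xj jN => ij.
    move: Ni; rewrite -ij inordK; last by rewrite ltnS ltnW.
    by rewrite leqNgt jN.
  move=> xN; rewrite /lump_index; case: ifPn => xN'.
    by exfalso; apply: xN; exists (idx x).
  by apply/val_inj/eqP; rewrite /= eqn_leq Ni/= -ltnS ltn_ord.
by apply: measurableC; apply: bigsetU_measurable => j _.
Qed.

Let iG (A : set T) : measurable A -> mu.-integrable setT (EFin \o (fun x => G x * \1_A x)).
Proof.
move=> mA; apply: (density_mul_integrable mG G0 G1 (measurable_indic mA)) => x.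
have h : `|\1_A x| <= 1 :> R by rewrite indicE ger0_norm ?ler0n// lern1 leq_b1.
exact: h.
Qed.

Lemma sum_cells N (phi : 'I_N.+1 -> R) :
  \int[mu]_x (G x * phi (lump_index N x)) = \sum_i phi i * lump cell_mass i.
Proof.
pose cm (i : 'I_N.+1) := \int[mu]_x (G x * \1_(lump_index N @^-1` [set i]) x).
have L1 (psi : 'I_N.+1 -> R) : \int[mu]_x (G x * psi (lump_index N x)) = \sum_i psi i * cm i.
  have -> : \int[mu]_x (G x * psi (lump_index N x)) =
      \int[mu]_x (\sum_i psi i * (G x * \1_(lump_index N @^-1` [set i]) x)).
    apply: eq_Rintegral => x _.
    rewrite (_ : psi _ = \sum_i psi i * \1_(lump_index N @^-1` [set i]) x); last first.
      by have /(congr1 (@^~ x)) := idx_indicE (lump_index N) psi.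
    by rewrite mulr_sumr; apply: eq_bigr => i _; rewrite mulrCA.
  rewrite /Rintegral; under eq_integral do rewrite -sumEFin.
  rewrite integral_sum//; last first.
    move=> i; exact: (integrableZl measurableT (psi i) (iG (measurable_lump_index i))).
  rewrite -sum_fine; last first.
    move=> i _; apply: integrable_fin_num => //.
    exact: (integrableZl measurableT (psi i) (iG (measurable_lump_index i))).
  apply: eq_bigr => i _; rewrite -/(Rintegral _ _ _).
  by rewrite RintegralZl//; exact/iG/measurable_lump_index.
have L2 (i : 'I_N.+1) : (i < N)%N -> cm i = cell_mass i.
  move=> iN; rewrite /cm lump_index_preimage// /cell_mass /Rintegral; congr fine.
  rewrite [RHS]integral_mkcond; apply: eq_integral => x _.
  by rewrite patchE indicE; case: ifP => _; rewrite ?mulr1 ?mulr0.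
rewrite L1; apply: eq_bigr => i _; congr (_ * _); rewrite /lump.
case: ifPn => [/eqP ->|im]; last first.
  by apply: L2; rewrite ltn_neqAle -ltnS ltn_ord andbT.
(* The mass of the remainder cell is obtained by subtraction, from the formula for the constant
   function 1. *)
have := L1 (fun=> 1); rewrite big_ord_recr/=.
have -> : \int[mu]_x (G x * 1) = 1.
  by under eq_Rintegral do rewrite mulr1; rewrite /Rintegral G1.
under eq_bigr do rewrite mul1r L2 ?ltn_ord//=.
by rewrite mul1r /tail => ->; rewrite addrAC subrr add0r.
Qed.

Lemma cell_mass_ge0 m : 0 <= cell_mass m.
Proof. by apply: fine_ge0; apply: integral_ge0 => x _; rewrite lee_fin. Qed.

Let trivI : trivIset setT (fun m => idx @^-1` [set m]).
Proof. by move=> i j _ _ [x [/= <- <-]]. Qed.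

Lemma cell_massE m : (mdensity mG G0 G1 (idx @^-1` [set m]) = (cell_mass m)%:E)%E.
Proof.
by rewrite /cell_mass fineK//; apply: (fin_num_measure (mdensity mG G0 G1)).
Qed.

Lemma tail_cell_mass_cvg : tail cell_mass n @[n --> \oo] --> 0.
Proof.
have := @measure_semi_sigma_additive _ _ _ (mdensity mG G0 G1) (fun m => idx @^-1` [set m]) midx trivI.
have -> : \bigcup_m (idx @^-1` [set m]) = setT.
  by apply/seteqP; split => // x _; exists (idx x).
move=> /(_ measurableT); rewrite [X in _ --> X](_ : _ = 1%:E); last exact: G1.
rewrite (_ : (fun _ => _) = EFin \o (fun n => \sum_(i < n) cell_mass i)); last first.
  by apply/funext => n /=; rewrite big_mkord -sumEFin; apply: eq_bigr => i _; rewrite -cell_massE.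
move=> /fine_cvg/= h; rewrite /tail -[X in _ --> X](subrr 1).
by apply: cvgB; [exact: cvg_cst|exact: h].
Qed.

(** [sum_cells] for the indicator of the remainder cell exhibits the tail as the integral of a
    nonnegative function. *)
Lemma sum_cell_mass_le1 n : \sum_(i < n) cell_mass i <= 1.
Proof.
have := sum_cells (fun i : 'I_n.+1 => (i == ord_max)%:R).
rewrite big_ord_recr/= eqxx mul1r big1 ?add0r; last first.
  by move=> i _; rewrite -val_eqE/= ltn_eqF// mul0r.
rewrite /lump eqxx /tail => E; rewrite -subr_ge0 -E.
by apply: Rintegral_ge0 => x _; rewrite mulr_ge0.
Qed.

End cell_masses.

Lemma measurable_L1 (R : realType) (b alpha : R) : measurable_fun setT (L1 b alpha).
Proof.
apply: measurable_fun_ifT => //=.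
- by apply: measurable_fun_ler => //; exact: measurableT_comp.
- by apply: measurable_funM => //; exact: measurable_funX.
- apply: measurable_funD => //; apply: measurable_funM => //; apply: measurable_funM => //.
  apply: (@measurableT_comp _ _ _ _ _ _ (@powR R ^~ alpha)) => //.
Qed.

Lemma measurable_Lcost (R : realType) (n : nat) (b alpha : R) :
  measurable_fun setT (fun z : borelRn R n * borelRn R n =>
    Lcost b alpha (z.1 - z.2 : 'rV[R]_n)).
Proof.
apply: measurable_sum => l; apply: measurableT_comp; first exact: measurable_L1.
have -> : (fun z : borelRn R n * borelRn R n => (z.1 - z.2 : 'rV[R]_n) 0 l) =
    (fun z => (z.1 : 'rV[R]_n) 0 l - (z.2 : 'rV[R]_n) 0 l).
  by apply/funext => z; rewrite !mxE.
apply: measurable_funB.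
  exact: (measurableT_comp (@measurable_coord R n l) measurable_fst).
exact: (measurableT_comp (@measurable_coord R n l) measurable_snd).
Qed.

(** By [dL1_le], [2 * delta * |dL1|] is at most [2 * delta * b] plus [4 * delta / b] times the cost.
    This is used at [z'], to compare the costs through the tangent there, and at [z], to subtract
    the derivative term: hence the square and the doubled additive error. *)
Lemma L1_perturb (R : realType) (b alpha delta z z' : R) :
  1 <= alpha <= 2 -> 0 < b -> 0 <= delta -> 4 * delta / b <= 1 -> `|z - z'| <= 2 * delta ->
  (1 - 4 * delta / b) ^+ 2 * L1 b alpha z' <=
    L1 b alpha z - 2 * delta * `|dL1 b alpha z| + 4 * delta * b.
Proof.
move=> a12 b0 d0; set th := 4 * delta / b => th1 zz'.
have /andP[a1 _] := a12.
have th0 : 0 <= th by rewrite divr_ge0 ?mulr_ge0// ltW.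
have bound w : 2 * delta * `|dL1 b alpha w| <= 2 * delta * b + th * L1 b alpha w.
  have -> : th * L1 b alpha w = 2 * delta * (2 / b * L1 b alpha w).
    by rewrite /th; field; rewrite gt_eqF.
  by rewrite -mulrDr ler_wpM2l ?mulr_ge0// dL1_le.
have T := L1_tangent z' z a1 b0.
have S : dL1 b alpha z' * (z' - z) <= 2 * delta * `|dL1 b alpha z'|.
  by rewrite (le_trans (ler_norm _))// normrM mulrC ler_wpM2r// distrC.
have B' := bound z'; have B := bound z.
have H : (1 - th) * L1 b alpha z' <= L1 b alpha z + 2 * delta * b.
  by move: T S B'; rewrite !mulrBr; lra.
have := ler_wpM2l (_ : 0 <= 1 - th) H; rewrite subr_ge0 => /(_ th1) H2.
have db : 0 <= th * (2 * delta * b) by exact: (mulr_ge0 th0 (mulr_ge0 (mulr_ge0 (ler0n _ _) d0) (ltW b0))).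
rewrite expr2 -mulrA; apply: (le_trans H2).
move: B db; set X := L1 b alpha z; set Y := `|dL1 b alpha z|; clear => *; nra.
Qed.

(** * Couplings at a fixed mesh, and the limit of vanishing mesh *)

Section coupling.
Context {R : realType} {n : nat}.
Variables (a alpha C : R) (mu : probability (borelRn R n) R).
Hypotheses (halpha : 1 <= alpha <= 2) (ha : 0 < a) (hC : 0 < C).
Hypothesis lsi : LSI a alpha C mu.
Let b := a * C / 2.
Variables (F : borelRn R n -> R) (r : R).
Hypotheses (mF : measurable_fun setT F) (F0 : forall x, 0 <= F x).
Hypothesis F1 : (\int[mu]_x (F x)%:E = 1)%E.
Hypothesis entF : (\int[mu]_x (F x * ln (F x))%:E = r%:E)%E.
Let V := C / 4 * r.

Let b0 : 0 < b. Proof. by rewrite divr_gt0// mulr_gt0. Qed.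

Lemma approximate_coupling (delta : R) : 0 < delta -> 4 * delta / b < 1 ->
  exists2 pi : probability (borelRn R n * borelRn R n)%type R,
    has_marginals pi (fun A => \int[mu]_(x in A) (F x)%:E)%E mu &
    (\int[pi]_z (Lcost b alpha (z.1 - z.2 : 'rV[R]_n))%:E <=
      ((V + n%:R * (4 * delta * b)) / (1 - 4 * delta / b) ^+ 2)%:E)%E.
Proof.
move=> d0 th1; pose idx : borelRn R n -> nat := grid_index delta.
pose y := @grid_point R n delta.
pose c (i j : nat) : R := Num.max 0 (\sum_l (L1 b alpha (y i 0 l - y j 0 l) -
   2 * delta * `|dL1 b alpha (y i 0 l - y j 0 l)|)).
have midx m : measurable (idx @^-1` [set m]) by exact: measurable_grid_cell.
pose one : borelRn R n -> R := cst 1.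
have m1 : measurable_fun setT one by [].
have one0 x : 0 <= one x by rewrite /one.
have int_one B : measurable B -> (\int[mu]_(x in B) (one x)%:E = mu B)%E.
  by move=> mB; transitivity (1%E * mu B)%E; [exact: (integral_cst mu mB 1%E)|exact: mul1e].
have one1 : (\int[mu]_x (one x)%:E = 1)%E.
  by rewrite int_one// probability_setT.
pose nuc := cell_mass mu F idx; pose muc := cell_mass mu one idx.
have dual N (phi psi : 'I_N.+1 -> R) :
    (forall i j, phi i + psi j <= lump_cost c i j) ->
    \sum_i phi i * lump nuc i + \sum_j psi j * lump muc j <= V.
  move=> h.
  rewrite -(sum_cells mF F0 F1 midx phi) -(sum_cells m1 one0 one1 midx psi).
  have -> : \int[mu]_x (one x * psi (lump_index idx N x)) = \int[mu]_x psi (lump_index idx N x).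
    by apply: eq_Rintegral => x _; rewrite mul1r.
  apply: (@dual_bound R n a alpha C mu halpha ha hC lsi N (fun i => y i)
    (lump_index idx N) delta _ _ F r mF F0 F1 entF phi psi h).
  - by move=> i; exact: measurable_lump_index.
  - by move=> x xm l; rewrite lump_index_lt//; exact: grid_near.
have c0 i j : 0 <= c i j by rewrite le_max lexx.
(* Nonnegativity of the entropy is read off from the dual bound with zero potentials and [N = 0],
   where only the remainder cell exists. *)
have V0 : 0 <= V.
  have z (i j : 'I_1) : (0 : R) + 0 <= lump_cost c i j.
    by rewrite addr0 /lump_cost; case: ifP.
  by have := dual 0%N (fun=> 0) (fun=> 0) z; rewrite !big_ord1 !mul0r addr0.
have [p [p0 pV prow pcol]] := infinite_transport c0 V0
  (cell_mass_ge0 mu idx F0) (cell_mass_ge0 mu idx one0)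
  (sum_cell_mass_le1 mF F0 F1 midx) (sum_cell_mass_le1 m1 one0 one1 midx) dual.
pose nu : probability (borelRn R n) R := mdensity mF F0 F1.
pose A m := idx @^-1` [set m].
have rows i : (\sum_(j <oo) (p i j)%:E = nu (A i))%E.
  rewrite [RHS](cell_massE mF F0 F1 midx).
  exact: (nneseries_squeeze (tail_cell_mass_cvg m1 one0 one1 midx) (prow i)).
have cols j : (\sum_(i <oo) (p i j)%:E = mu (A j))%E.
  have -> : mu (A j) = mdensity m1 one0 one1 (A j).
    by rewrite /mdensity int_one//; exact: midx.
  rewrite [RHS](cell_massE m1 one0 one1 midx).
  exact: (nneseries_squeeze (tail_cell_mass_cvg mF F0 F1 midx) (pcol j)).
have tA : trivIset setT A by move=> i j _ _ [x [/= <- <-]].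
have cA : \bigcup_i A i = setT by apply/seteqP; split => // x _; exists (idx x).
have [pi [pi_fst pi_snd pi_cost]] := gluing midx tA cA p0 rows cols.
exists pi; first by move=> B mB; split; [exact: pi_fst|exact: pi_snd].
have s0 : 0 < (1 - 4 * delta / b) ^+ 2 by rewrite exprn_gt0// subr_gt0.
have k0 : 0 <= n%:R * (4 * delta * b).
  exact: (mulr_ge0 (ler0n _ _) (mulr_ge0 (mulr_ge0 (ler0n _ _) (ltW d0)) (ltW b0))).
(* An upper bound of the true cost between two cells, from [L1_perturb] summed over the [n]
   coordinates. The plan has total mass at most 1, so the additive term enters at most once. *)
pose e i j := (c i j + n%:R * (4 * delta * b)) / (1 - 4 * delta / b) ^+ 2.
apply: (pi_cost _ e).
- by apply/measurable_EFinP; exact: measurable_Lcost.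
- move=> z; rewrite lee_fin; apply: sumr_ge0 => l _; apply: L1_ge0 => //.
  by case/andP: halpha.
- by move=> i j; rewrite divr_ge0 ?addr_ge0// ltW.
- move=> i j x x' xi xj; rewrite lee_fin /e ler_pdivlMr// mulrC /Lcost mulr_sumr.
  apply: le_trans (_ : _ <= \sum_l (L1 b alpha (y i 0 l - y j 0 l) -
     2 * delta * `|dL1 b alpha (y i 0 l - y j 0 l)| + 4 * delta * b)) _.
    apply: ler_sum => l _; rewrite !mxE; apply: L1_perturb => //; [exact: ltW|exact: ltW|].
    have := grid_near d0 x l; have := grid_near d0 x' l.
    rewrite -/(idx x) -/(idx x') -/(y _) -/(y _) xi xj !ler_norml.
    set u := y i 0 l; set v := y j 0 l; set s := x 0 l; set t := x' 0 l.
    by move=> /andP[? ?] /andP[? ?]; apply/andP; split; lra.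
  rewrite big_split/= sumr_const card_ord -[_ *+ n]mulr_natl lerD2r.
  by rewrite le_max lexx orbT.
move=> K.
have -> : \sum_(i < K) \sum_(j < K) e i j * p i j =
    (\sum_(i < K) \sum_(j < K) c i j * p i j +
     n%:R * (4 * delta * b) * \sum_(i < K) \sum_(j < K) p i j) / (1 - 4 * delta / b) ^+ 2.
  rewrite mulr_sumr -big_split/= mulr_suml; apply: eq_bigr => i _.
  rewrite mulr_sumr -big_split/= mulr_suml; apply: eq_bigr => j _.
  by rewrite /e mulrAC -mulrDl.
rewrite ler_pM2r ?invr_gt0// lerD// ler_piMr//.
apply: le_trans (sum_cell_mass_le1 mF F0 F1 midx K); apply: ler_sum => i _.
by have /andP[] := prow i K.
Qed.

(** The transport cost is an infimum, so couplings of cost at most [V + eta] for every [eta > 0]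
    suffice, without passing to a limit of couplings. *)
Lemma transport_cost_le :
  (transport_cost b alpha (fun A => \int[mu]_(x in A) (F x)%:E) mu <= V%:E)%E.
Proof.
apply/lee_addgt0Pr => eta eta0.
have idc : (fun x : R => x) @ 0^'+ --> (0 : R) by apply: cvg_at_right_filter; exact: cvg_id.
have lin (k : R) : (fun x : R => x * k) @ 0^'+ --> (0 : R).
  by rewrite -[X in _ --> X](mul0r k); apply: cvgM => //; exact: cvg_cst.
have den : (fun x : R => (1 - x * (4 / b)) ^+ 2) @ 0^'+ --> (1 : R).
  have h : (fun x : R => 1 - x * (4 / b)) @ 0^'+ --> (1 : R).
    by rewrite -[X in _ --> X]subr0; apply: cvgB; [exact: cvg_cst|exact: lin].
  by rewrite -[X in _ --> X](mulr1 1); under eq_fun do rewrite expr2; exact: cvgM.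
have lim : (fun x : R => (V + x * (n%:R * 4 * b)) * ((1 - x * (4 / b)) ^+ 2)^-1) @ 0^'+ --> V.
  rewrite [X in _ --> X](_ : V = (V + 0) * 1^-1); last by rewrite addr0 invr1 mulr1.
  apply: cvgM; last by apply: cvgV => //; rewrite oner_eq0.
  by apply: cvgD; [exact: cvg_cst|exact: lin].
have [d [d0 d1 dV]] : exists d : R, [/\ 0 < d, d < b / 4 &
    (V + d * (n%:R * 4 * b)) * ((1 - d * (4 / b)) ^+ 2)^-1 <= V + eta].
  have ne : \forall x \near 0^'+, [/\ 0 < x, x < b / 4 &
      (V + x * (n%:R * 4 * b)) * ((1 - x * (4 / b)) ^+ 2)^-1 <= V + eta].
    near=> x; split => //.
      by near: x; apply: nbhs_right_lt; rewrite divr_gt0.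
    by near: x; apply: (cvgr_le _ lim); rewrite ltrDl.
  by have [d hd] := filter_ex ne; exists d.
have th : 4 * d / b < 1 by rewrite ltr_pdivrMr//; lra.
have [pi hpi cost] := approximate_coupling d0 th.
apply: (@le_trans _ _ (\int[pi]_z (Lcost b alpha (z.1 - z.2 : 'rV[R]_n))%:E)%E).
  by apply: ereal_inf_lbound; exists pi.
apply: le_trans cost _; rewrite -EFinD lee_fin; apply: le_trans dV.
rewrite le_eqVlt; apply/orP; left; apply/eqP; congr (_ / _).
  by ring.
by congr (_ ^+ 2); ring.
Unshelve. all: by end_near. Qed.

End coupling.

Theorem theorem2p8 (R : realType) (n : nat) (a alpha C : R)
  (mu : probability (borelRn R n) R)
  (halpha : 1 <= alpha <= 2) (ha : 0 < a) (hC : 0 < C) :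
  LSI a alpha C mu ->
  transport_inequality (a * C / 2) alpha (C / 4) mu.
Proof.
move=> lsi F [mF F0 F1].
have EntE : Ent mu F = (\int[mu]_x (F x * ln (F x))%:E)%E.
  rewrite /Ent; apply: eq_integral => x _.
  by rewrite /Rintegral F1 divr1.
have C4 : 0 < C / 4 by rewrite divr_gt0.
(* The value [-oo] of the entropy is excluded, and [+oo] makes the right-hand side infinite; the
   case left is a real [r]. *)
have := density_entropy_gtNy mu F0; rewrite EntE.
case entF : (\int[mu]_x _)%E => [r| |] // _.
  by rewrite -EFinM; exact: transport_cost_le mF F0 F1 entF.
by rewrite gt0_muley ?lte_fin// leey.
Qed.
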